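(* Let $\omega$ be a non-principal ultrafilter on $\mathbb N$. Let $\big((X_i,d_i,\mathfrak m_i,p_i)\big)_{i\in\mathbb N}$ be a sequence of pointed Polish metric measure spaces with boundedly finite measures that converges, in the weak pointed measured Gromov--Hausdorff sense, to a pointed Polish metric measure space $(X_\infty,d_\infty,\mathfrak m_\infty,p_\infty)$ with boundedly finite measure. Then $\big((X_i,d_i,\mathfrak m_i,p_i)\big)_{i\in\mathbb N}$ is asymptotically boundedly $\mathfrak m_\omega$-totally bounded, and its limit $(X_\infty,d_\infty,\mathfrak m_\infty,p_\infty)$ is isomorphic to $({\rm spt}(\mathfrak m_\omega),d_\omega,\mathfrak m_\omega,p_\omega)$.
   Context: For a metric space $(X,d)$, $B(x,r)$, $\bar B(x,r)$ are open/closed balls, $A^r:=\{x:{\rm dist}(x,A)<r\}$, ${\rm Ball}(X)$ is the $\sigma$-algebra generated by open balls (equal to the Borel $\sigma$-algebra if $X$ is separable). A Polish metric measure space is a complete separable metric space with a Borel measure; pointed means a point is chosen; boundedly finite means finite on balls. ${\rm spt}(\mathfrak m):=\{x:\mathfrak m(B(x,r))>0\ \forall r>0\}$. $C_{bbs}(X)$ is the set of bounded continuous functions $X\to\mathbb R$ with bounded support. An isomorphism from $(X,d_X,\mathfrak m_X,p_X)$ to $(Y,d_Y,\mathfrak m_Y,p_Y)$ is a Borel map $\varphi\colon X\to Y$ with $\varphi(p_X)=p_Y$ such that $\varphi|_{{\rm spt}(\mathfrak m_X)}$ is an isometry and $\varphi_*\mathfrak m_X=\mathfrak m_Y$. Weak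 $(R,\varepsilon)$-approximation ($0<\varepsilon<R$) from $(X,d_X,\mathfrak m_X,p_X)$ to $(Y,d_Y,\mathfrak m_Y,p_Y)$: a Borel map $\psi\colon B(p_X,R)\to Y$ with $\psi(p_X)=p_Y$ for which there is a Borel set $\tilde X\subset B(p_X,R)$ containing $p_X$ with (1) $|d_X(x,y)-d_Y(\psi(x),\psi(y))|\le\varepsilon$ for all $x,y\in\tilde X$; (2) $\mathfrak m_X(B(p_X,R)\setminus\tilde X)\le\varepsilon$ and $\mathfrak m_Y\big(B(p_Y,R-\varepsilon)\setminus\psi(\tilde X)^\varepsilon\big)\le\varepsilon$. Such a map can always be extended in a Borel manner to the whole space $X$, and weak approximations are regarded as (so extended) Borel maps $\psi\colon X\to Y$. Weak pointed measured Gromov--Hausdorff (wpmGH) convergence of $(X_i,d_i,\mathfrak m_i,p_i)$ to $(X_\infty,d_\infty,\mathfrak m_\infty,p_\infty)$: there are $R_i\nearrow+\infty$, $\varepsilon_i\searrow0$ and weak $(R_i,\varepsilon_i)$-approximations $\psi_i\colon X_i\to X_\infty$ with $(\psi_i)_*\mathfrak m_i\rightharpoonup\mathfrak m_\infty$ in duality with $C_{bbs}(X_\infty)$, i.e. $\int\varphi\circ\psi_i\,d\mathfrak m_i\to\int\varphi\,d\mathfrak m_\infty$ for all $\varphi\in C_{bbs}(X_\infty)$. Asymptotically boundedly $\mathfrak m_\omega$-totally bounded: the sequence is $\omega$-uniformly boundedly finite (for every $R>0$ there is $\eta(R)<+\infty$ with $\mathfrak m_i(B(p_i,R))\le\eta(R)$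 for $\omega$-a.e. $i$), and for every $R,r,\varepsilon>0$ there are $M\in\mathbb N$ and points $(x^i_n)_{n=1}^M\subset X_i$ with $\lim_{i\to\omega}\mathfrak m_i\big(\bar B(p_i,R)\setminus\bigcup_{n=1}^MB(x^i_n,r)\big)\le\varepsilon$. Ultralimit $(X_\omega,d_\omega,\mathfrak m_\omega,p_\omega)$. ''For $\omega$-a.e. $i$'' means for all $i$ in some element of $\omega$. Let $\bar X_\omega$ be the set of families $(x_i)_{i\in S}$, $S\in\omega$, $x_i\in X_i$, modulo equality for $\omega$-a.e. $i$ (classes $[x_i]$); $\bar d_\omega([x_i],[y_i]):=\lim_{i\to\omega}d_i(x_i,y_i)$; $O(\bar X_\omega):=\{[x_i]:\bar d_\omega([x_i],[p_i])<+\infty\}$. $X_\omega$ is the quotient of $O(\bar X_\omega)$ by $\bar d_\omega=0$, with classes $[[x_i]]$, induced distance $d_\omega$, projection $\pi$, and $p_\omega:=[[p_i]]$. For $S\in\omega$, $A_i\in{\rm Ball}(X_i)$, $i\in S$, let $\Pi_{i\to\omega}A_i:=\{[x_i]\in\bar X_\omega:x_i\in A_i\text{ for }\omega\text{-a.e. }i\}$; $\mathcal A_O(\bar X_\omega)$ is the algebra of all sets $(\Pi_{i\to\omega}A_i)\cap O(\bar X_\omega)$, and $\bar{\mathfrak m}_\omega\big((\Pi_{i\to\omega}A_i)\cap O(\bar X_\omega)\big):=\lim_{R\to\infty}\lim_{i\to\omega}\mathfrak m_i(A_i\cap B(p_i,R))$. $N\subset O(\bar X_\omega)$ is null ($N\in\mathcal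 N_\omega$) if for every $\varepsilon>0$ there is $\bar A\in\mathcal A_O(\bar X_\omega)$ with $N\subset\bar A$, $\bar{\mathfrak m}_\omega(\bar A)<\varepsilon$. $\bar{\mathcal B}_\omega$ is the family of $A\subset O(\bar X_\omega)$ such that for every $R>0$ there is $\bar A_R\in\mathcal A_O(\bar X_\omega)$ with $(A\cap\Pi_{i\to\omega}B(p_i,R))\Delta\bar A_R\in\mathcal N_\omega$; for such $A$, $\bar{\mathfrak m}_\omega(A):=\lim_{R\to\infty}\bar{\mathfrak m}_\omega(\bar A_R)$. Under $\omega$-uniform bounded finiteness, $\bar{\mathcal B}_\omega$ is a $\sigma$-algebra, $\bar{\mathfrak m}_\omega$ a measure on it, $\pi^{-1}(A)\in\bar{\mathcal B}_\omega$ for $A\in{\rm Ball}(X_\omega)$, and $\mathfrak m_\omega(A):=\bar{\mathfrak m}_\omega(\pi^{-1}(A))$ for $A\in{\rm Ball}(X_\omega)$. ${\rm spt}(\mathfrak m_\omega)$ is closed and separable; it carries the restricted distance and measure.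
   Formalization: In wpmGH convergence the push-forward is of m_i restricted to B(p_i,R_i), since with arbitrary Borel extensions to X_i the claim fails (mass escaping to infinity may be mapped back); and p_ω is adjoined to spt(m_ω), which need not contain it. *)

(* Defs.v *)
From HB Require Import structures.
From mathcomp Require Import all_boot all_order all_algebra generic_quotient.
From mathcomp Require Import all_classical all_reals all_analysis.

Set Implicit Arguments.
Unset Strict Implicit.
Unset Printing Implicit Defensive.
Import Order.TTheory GRing.Theory Num.Theory.
Import numFieldNormedType.Exports.
Import metricType_numDomainType.

Local Open Scope classical_set_scope.
Local Open Scope ring_scope.

(* Pointed metric spaces: the distinguished point is the library's [point]. *)
#[short(type="pmetricType")]
HB.structure Definition PointedMetric (K : numDomainType) :=
  { M of Metric K M & isPointed M }.

Notation borel X := (g_sigma_algebraType (@open X)).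

Section metric_measure.
Context {R : realType}.
Implicit Types X Y : pmetricType R.

Definition ball_sigma X : set_system X :=
  <<s [set A : set X | exists x r, A = ball x r] >>.

(* The library's [closed_ball] is the closure of the open ball, which may be
   strictly smaller. *)
Definition cball X (x : X) (r : R) : set X := [set y | mdist x y <= r].

Definition thickening X (A : set X) (r : R) : set X :=
  [set x | (ereal_inf [set (mdist x a)%:E | a in A] < r%:E)%E].

Definition polish X : Prop :=
  (forall F : set_system X, ProperFilter F -> cauchy F -> cvg F) /\
  (exists D : set X, countable D /\ dense D).

Definition boundedly_finite X (mu : set X -> \bar R) : Prop :=
  forall x r, (mu (ball x r) < +oo)%E.

Definition spt X (mu : set X -> \bar R) : set X :=
  [set x | forall r : R, 0 < r -> (0 < mu (ball x r))%E].

Definition Cbbs Y (f : Y -> R) : Prop :=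
  [/\ continuous f, bounded_fun (f : Y -> R^o) &
      exists r : R, [set y | f y != 0] `<=` ball point r].

Definition is_isomorphism X Y (muX : set X -> \bar R) (muY : set Y -> \bar R)
    (phi : X -> Y) : Prop :=
  [/\ measurable_fun setT (phi : borel X -> borel Y),
      phi point = point,
      forall x y, spt muX x -> spt muX y -> mdist (phi x) (phi y) = mdist x y &
      forall A : set (borel Y), measurable A ->
        pushforward (muX : set (borel X) -> \bar R)
                    (phi : borel X -> borel Y) A = muY A].

Definition isomorphic X Y (muX : set X -> \bar R) (muY : set Y -> \bar R) : Prop :=
  exists phi : X -> Y, is_isomorphism muX muY phi.

(* Only the values of [psi] on [ball point r] are constrained: [psi]
   stands for a Borel map defined on that ball. *)
Definition weak_approximation X Y (muX : set X -> \bar R) (muY : set Y -> \bar R)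
    (r e : R) (psi : X -> Y) : Prop :=
  [/\ 0 < e < r,
      measurable_fun (ball point r : set (borel X)) (psi : borel X -> borel Y),
      psi point = point &
      exists Xt : set X,
        [/\ measurable (Xt : set (borel X)), Xt `<=` ball point r, Xt point,
            forall x y, Xt x -> Xt y ->
              `|mdist x y - mdist (psi x) (psi y)| <= e &
            (muX (ball point r `\` Xt) <= e%:E)%E /\
            (muY (ball point (r - e) `\` thickening (psi @` Xt) e) <= e%:E)%E]].

(* The push-forward of [m i] is taken on the ball where [psi i] is a weak
   approximation. An arbitrary Borel extension of [psi i] to [X i] could bring
   mass that escapes to infinity back to bounded regions of [Y].
   The integrals are extended-real valued, so convergence to the finite limit
   forces [f \o psi i] to be eventually integrable. *)
Definition wpmGH (X : nat -> pmetricType R)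
    (m : forall i, {measure set (borel (X i)) -> \bar R})
    (Y : pmetricType R) (mY : {measure set (borel Y) -> \bar R}) : Prop :=
  exists (r e : nat -> R) (psi : forall i, X i -> Y),
    [/\ nondecreasing_seq r /\ r i @[i --> \oo] --> +oo%R,
        nonincreasing_seq e /\ e i @[i --> \oo] --> (0 : R),
        forall i, weak_approximation (m i) mY (r i) (e i) (psi i) &
        forall f : Y -> R, Cbbs f ->
          (\int[m i]_(x in (ball point (r i) : set (borel (X i))))
             (f (psi i x))%:E)%E @[i --> \oo]
          --> (\int[mY]_(y in (setT : set (borel Y))) (f y)%:E)%E].

End metric_measure.

Section submetric.
Context {R : realType} {X : metricType R} (A : set X).

Definition sub_mdist (x y : A) : R := mdist (set_val x) (set_val y).

Lemma sub_mdist_ge0 x y : 0 <= sub_mdist x y.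
Proof. exact: mdist_ge0. Qed.

Lemma sub_mdist_positivity x y : sub_mdist x y = 0 -> x = y.
Proof. by move=> /mdist_positivity/val_inj. Qed.

Lemma sub_ballE (x : A) d : ball x d = [set y | sub_mdist x y < d].
Proof.
rewrite [LHS](_ : _ = [set y | ball (set_val x) d (set_val y)])//.
by rewrite ballEmdist.
Qed.

HB.instance Definition _ := PseudoMetric_isMetric.Build R (A : Type)
  sub_mdist_ge0 sub_mdist_positivity sub_ballE.

End submetric.

Section ultrafilter_limits.
Context {R : realType} {omega : set_system nat} (ultra : UltraFilter omega).

Lemma ultra_cvg_ge0 (u : nat -> R) : (forall i, 0 <= u i) ->
  cvg ((u i)%:E @[i --> omega]).
Proof.
move=> u0; have [[M uM]|noM] := pselect (exists M, \forall i \near omega, u i <= M).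
  have FM : (u @ omega) `[0, M]%classic.
    by apply: filterS uM => i uiM; rewrite /= in_itv/= u0.
  have [c [_ clc]] := @segment_compact R 0 M (u @ omega) _ FM.
  apply/cvg_ex; exists c%:E; apply: cvg_EFin; first exact: nearW.
  move=> B Bc; have [//|nB] := in_ultra_setVsetC (u @^-1` B) ultra.
  by have [y [+ By]] := clc (~` B) B nB Bc; case.
apply/cvg_ex; exists +oo%E; apply/cvgeryP/cvgryPgt => M.
have [uM|uM] := in_ultra_setVsetC [set i | u i <= M] ultra.
  by exfalso; apply: noM; exists M.
by apply: filterS uM => i /negP; rewrite -ltNge.
Qed.

End ultrafilter_limits.

Section ultralimit.
Context {R : realType} {omega : set_system nat} (ultra : UltraFilter omega)
        (X : nat -> pmetricType R).

(* Families are taken to be indexed by all of [nat]: a family indexed by a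
   member of [omega] extends by [point], and only its values along [omega]
   matter. *)
Definition ae_eq_fam (x y : forall i, X i) : bool :=
  `[< \forall i \near omega, x i = y i >].

Lemma ae_eq_fam_refl : reflexive ae_eq_fam.
Proof. by move=> x; apply/asboolP; apply: nearW. Qed.

Lemma ae_eq_fam_sym : symmetric ae_eq_fam.
Proof.
by move=> x y; apply/asboolP/asboolP; apply: filterS => i ->.
Qed.

Lemma ae_eq_fam_trans : transitive ae_eq_fam.
Proof.
move=> y x z /asboolP xy /asboolP yz; apply/asboolP.
by apply: filterS2 xy yz => i -> ->.
Qed.

Canonical ae_eq_fam_equiv :=
  EquivRel ae_eq_fam ae_eq_fam_refl ae_eq_fam_sym ae_eq_fam_trans.

Definition Xbar := {eq_quot ae_eq_fam}%qT.
HB.instance Definition _ := Choice.on Xbar.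

Definition dbar (x y : Xbar) : \bar R :=
  lim ((mdist (repr x i) (repr y i))%:E @[i --> omega]).

Definition pbar : Xbar := \pi_{eq_quot ae_eq_fam}%qT (fun i => point).

Definition Obar : set Xbar := [set x | (dbar x pbar < +oo)%E].

Lemma dbar_cvg (x y : Xbar) : (mdist (repr x i) (repr y i))%:E @[i --> omega]
  --> dbar x y.
Proof. by apply: ultra_cvg_ge0 => i; exact: mdist_ge0. Qed.

Lemma dbar_ge0 (x y : Xbar) : (0 <= dbar x y)%E.
Proof.
apply: lime_ge; first exact: dbar_cvg.
by apply: nearW => i; rewrite lee_fin mdist_ge0.
Qed.

Lemma dbarxx (x : Xbar) : dbar x x = 0%E.
Proof.
rewrite /dbar (_ : (fun i => _) = cst 0%E) ?lim_cst//.
by apply/funext => i; rewrite mdistxx.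
Qed.

Lemma dbar_sym (x y : Xbar) : dbar x y = dbar y x.
Proof. by rewrite /dbar; under eq_fun do rewrite metric_sym. Qed.

Lemma dbar_triangle (y x z : Xbar) : (dbar x z <= dbar x y + dbar y z)%E.
Proof.
have def : (dbar x y +? dbar y z)%E by rewrite ge0_adde_def ?inE ?dbar_ge0.
have xyz := cvgeD def (@dbar_cvg x y) (@dbar_cvg y z) _.
rewrite -(cvg_lim _ (xyz _))//; apply: lee_lim.
- exact: dbar_cvg.
- by apply/cvg_ex; exists (dbar x y + dbar y z)%E; exact: xyz.
- by apply: nearW => i; rewrite -EFinD lee_fin metric_triangle.
Qed.

Lemma Obar_pbar : Obar pbar.
Proof. by rewrite /Obar/= dbarxx. Qed.

Definition OX : Type := Obar.
HB.instance Definition _ := Choice.on OX.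

Lemma dbar_OX_fin (x y : OX) : dbar (val x) (val y) \is a fin_num.
Proof.
rewrite ge0_fin_numE ?dbar_ge0//.
apply: le_lt_trans (dbar_triangle pbar _ _) _; rewrite lte_add_pinfty//.
  exact: (set_valP x).
by rewrite dbar_sym; exact: (set_valP y).
Qed.

Definition dist0 (x y : OX) : bool := dbar (val x) (val y) == 0%E.

Lemma dist0_refl : reflexive dist0.
Proof. by move=> x; rewrite /dist0 dbarxx. Qed.

Lemma dist0_sym : symmetric dist0.
Proof. by move=> x y; rewrite /dist0 dbar_sym. Qed.

Lemma dist0_trans : transitive dist0.
Proof.
move=> y x z /eqP xy /eqP yz; rewrite /dist0 eq_le dbar_ge0 andbT.
by apply: le_trans (dbar_triangle (val y) _ _) _; rewrite xy yz adde0.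
Qed.

Canonical dist0_equiv := EquivRel dist0 dist0_refl dist0_sym dist0_trans.

Definition ultralimit : Type := {eq_quot dist0}%qT.
HB.instance Definition _ := Choice.on ultralimit.

Definition to_ultralimit : OX -> ultralimit := \pi_{eq_quot dist0}%qT.

Definition pOX : OX := exist _ pbar (mem_set Obar_pbar).

HB.instance Definition _ := isPointed.Build ultralimit (to_ultralimit pOX).

Definition ultradist (x y : ultralimit) : R :=
  fine (dbar (val (repr x)) (val (repr y))).

Lemma ultradistE x y : (ultradist x y)%:E = dbar (val (repr x)) (val (repr y)).
Proof. by rewrite fineK// dbar_OX_fin. Qed.

Lemma ultradistxx x : ultradist x x = 0.
Proof. by rewrite /ultradist dbarxx. Qed.

Lemma ultradist_positivity x y : ultradist x y = 0 -> x = y.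
Proof.
move=> xy0; rewrite -[x]reprK -[y]reprK; apply/eqmodP.
by rewrite /= /dist0 -ultradistE xy0.
Qed.

Lemma ultradist_sym x y : ultradist x y = ultradist y x.
Proof. by rewrite /ultradist dbar_sym. Qed.

Lemma ultradist_triangle y x z :
  ultradist x z <= ultradist x y + ultradist y z.
Proof. by rewrite -lee_fin EFinD !ultradistE dbar_triangle. Qed.

HB.instance Definition _ := isMetric.Build R ultralimit
  ultradistxx ultradist_positivity ultradist_sym ultradist_triangle.

End ultralimit.

Section ultralimit_measure.
Context {R : realType} {omega : set_system nat} (ultra : UltraFilter omega)
        {X : nat -> pmetricType R}
        (m : forall i, {measure set (borel (X i)) -> \bar R}).
Notation OX := (OX ultra X).

(* The trace on O(Xbar) of the internal set defined by the sets [A i]; it does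
   not depend on the representative [repr], which is unique up to equality
   along [omega]. *)
Definition internal (A : forall i, set (X i)) : set OX :=
  [set x : OX | \forall i \near omega, A i (repr (val x) i)].

Definition internal_rep (B : set OX) (A : forall i, set (X i)) : Prop :=
  (forall i, ball_sigma (A i)) /\ internal A = B.

Definition internal_algebra : set_system OX :=
  [set B | exists A, internal_rep B A].

(* The value does not depend on the family chosen to represent [B]. *)
Definition internal_measure (B : set OX) : \bar R :=
  let A := xget (fun=> set0) (internal_rep B) in
  lim (lim (m i (A i `&` ball point r) @[i --> omega]) @[r --> +oo%R]).

Definition null (N : set OX) : Prop :=
  forall e : R, 0 < e -> exists B, [/\ internal_algebra B, N `<=` B &
    (internal_measure B < e%:E)%E].

Definition approximant (A : set OX) (r : R) (B : set OX) : Prop :=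
  internal_algebra B /\
  null ((A `&` internal (fun i => ball point r)) `+` B).

(* A sigma-algebra on which [mbar] is a measure if the [m i] are uniformly
   finite on balls along [omega]. *)
Definition Bbar : set_system OX :=
  [set A | forall r : R, 0 < r -> exists B, approximant A r B].

(* The value does not depend on the approximating sets, which are unique up to
   null sets. *)
Definition mbar (A : set OX) : \bar R :=
  lim (internal_measure (xget set0 (approximant A r)) @[r --> +oo%R]).

Definition ultrameasure (A : set (ultralimit ultra X)) : \bar R :=
  mbar (@to_ultralimit _ _ ultra X @^-1` A).

Definition asymptotically_totally_bounded : Prop :=
  (forall r : R, 0 < r -> exists eta : R,
     \forall i \near omega, (m i (ball point r) <= eta%:E)%E) /\
  (forall r s e : R, 0 < r -> 0 < s -> 0 < e ->
     exists (M : nat) (x : forall i, nat -> X i),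
       (lim (m i (cball point r `\` \bigcup_(n < M) ball (x i n) s)
             @[i --> omega]) <= e%:E)%E).

(* [point] need not belong to the support, e.g. when it is isolated and has
   mass zero or when the measure vanishes, and is then adjoined to it so that
   the support is a pointed space. *)
Definition ultraspt_set : set (ultralimit ultra X) :=
  spt ultrameasure `|` [set point].

Definition ultraspt : Type := ultraspt_set.
HB.instance Definition _ := Metric.on ultraspt.

Lemma ultraspt_point : ultraspt_set point. Proof. by right. Qed.

HB.instance Definition _ := isPointed.Build ultraspt
  (exist _ point (mem_set ultraspt_point)).

Definition ultraspt_measure (A : set ultraspt) : \bar R :=
  ultrameasure (set_val @` A).

End ultralimit_measure.

Arguments asymptotically_totally_bounded {R} omega {X} m.
Arguments ultraspt_measure {R omega} ultra {X} m A.

(* Main.v *)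
(** The weak approximations psi_i send almost every class [x_i] of the ultraproduct
    to lim psi_i(x_i) in the limit space: covering a bounded part of the limit by
    finitely many small balls up to a set of small measure, weak convergence forces
    psi_i(x_i) into one of these balls for most x_i, so the exceptional set is null
    by saturation. By regularity of Borel measures and weak convergence, the
    preimage of a Borel set C under this almost everywhere defined map is Loeb
    measurable, of measure m_oo(C). Since the distortion of psi_i tends to 0, the
    map is inverse to an isometric embedding of spt(m_oo) into the ultralimit, which
    therefore carries m_oo to m_omega. *)
Require Import Defs.
From mathcomp Require Import all_boot all_order all_algebra generic_quotient.
From mathcomp Require Import all_classical all_reals all_analysis.
From mathcomp Require Import measurable_realfun lra.

Set Implicit Arguments.
Unset Strict Implicit.
Unset Printing Implicit Defensive.
Import Order.TTheory GRing.Theory Num.Theory.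
Import numFieldNormedType.Exports.

Local Open Scope classical_set_scope.
Local Open Scope ring_scope.

(** The ultralimit measure rests on arbitrary choices, of families that represent internal sets and
    of approximants at each radius. The estimates are therefore proved for every admissible choice
    and phrased with an outer content given by internal covers, which is countably subadditive and
    detects null sets. For a bounded open set, weak convergence gives two one-sided bounds: the
    preimages have asymptotically at least its mass, and the preimages of the points at a fixed
    depth inside it have at most its mass. The upper bound extends to all classes whose limit lies
    in the open set, since such a limit has positive depth. A Borel set has no useful open subset in
    general, so its lower bound is obtained from the upper bound for its complement in a ball.
    Distortion and limits both spoil strict inequalities between distances, which explains the
    slightly larger or smaller radii throughout. *)

Notation bmeas A := (measurable (A : set (borel _))).

(** * Metric spaces and cut-off functions *)

Section metric_topology.
Context {R : realType} {Y : pmetricType R}.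
Implicit Types (V : set Y) (x y z : Y).

Lemma mballE x (r : R) y : ball x r y = (mdist x y < r) :> Prop.
Proof. by rewrite ballEmdist. Qed.

Lemma open_mdistP V :
  open V <-> forall x, V x -> exists2 e : R, 0 < e & ball x e `<=` V.
Proof.
rewrite openE; split=> VV x Vx.
  by have /nbhs_ballP[e e0 xV] := VV x Vx; exists e.
by apply/nbhs_ballP; have [e e0 xV] := VV x Vx; exists e.
Qed.

Lemma open_mball x (r : R) : open (ball x r).
Proof.
apply/open_mdistP => y; rewrite mballE => xy; exists (r - mdist x y).
  by rewrite subr_gt0.
move=> z; rewrite !mballE => yz; have := metric_triangle x y z; lra.
Qed.

Lemma open_setC_cball x (r : R) : open (~` cball x r).
Proof.
apply/open_mdistP => y /negP; rewrite -ltNge => xy; exists (mdist x y - r).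
  by rewrite subr_gt0.
move=> z; rewrite mballE => yz; apply/negP; rewrite -ltNge.
have := metric_triangle x z y; rewrite (metric_sym z y); lra.
Qed.

Lemma dense_seq : polish Y ->
  exists u : nat -> Y, forall x (e : R), 0 < e -> exists n, mdist (u n) x < e.
Proof.
move=> [_ [D [cD dD]]].
have [y0 Dy0] : D !=set0.
  by have [y [_ Dy]] := dD setT (ex_intro _ point I) openT; exists y.
have /(@countable_injP _ D)[g gi] := cD.
exists (fun n => xget y0 [set y | D y /\ g y = n]) => x e e0.
have xe : ball x e x by rewrite mballE mdistxx.
have [y [xy Dy]] := dD (ball x e) (ex_intro _ x xe) (open_mball x e).
exists (g y); have hy : exists z, D z /\ g z = g y by exists y.
have [Dz gz] := xgetPex y0 hy.
set z := xget _ _ in Dz gz *.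
have -> : z = y by apply: gi => //; rewrite inE.
by move: xy; rewrite mballE metric_sym.
Qed.

(** A countable base of balls: it turns open sets into countable unions of balls, and the complement
    of the support into a countable union of null balls. *)
Lemma dense_seq_ball (u : nat -> Y) V x : open V -> V x ->
  (forall x (e : R), 0 < e -> exists n, mdist (u n) x < e) ->
  exists n k, ball (u n) (k.+1%:R^-1 : R) `<=` V /\ ball (u n) (k.+1%:R^-1 : R) x.
Proof.
move=> /open_mdistP VV /VV[e e0 xV] ud.
have e20 : 0 < e / 2 by rewrite divr_gt0.
have [k] := ltr_add_invr e20; rewrite add0r => ke.
have k0 : 0 < k.+1%:R^-1 :> R by rewrite invr_gt0.
have [n nx] := ud x _ k0; exists n, k; split; last by rewrite mballE.
move=> z; rewrite mballE => nz; apply: xV; rewrite mballE.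
apply: le_lt_trans (metric_triangle x (u n) z) _.
by rewrite (metric_sym x) [e]splitr ltrD// (lt_trans _ ke).
Qed.

(* The distance from [y] to the complement of [V], truncated at 1; unlike an
   infimum of distances, it makes sense when that complement is empty. *)
Definition inradius V y : R := sup [set s | 0 <= s <= 1 /\ ball y s `<=` V].

Let inradius_has_sup V y : has_sup [set s : R | 0 <= s <= 1 /\ ball y s `<=` V].
Proof.
split; last by exists 1 => s [/andP[]].
exists 0; split; first by rewrite lexx ler01.
by move=> z; rewrite mballE ltNge mdist_ge0.
Qed.

Lemma le_inradius V y (s : R) : 0 <= s <= 1 -> ball y s `<=` V ->
  s <= inradius V y.
Proof. by move=> s01 sV; apply: (sup_upper_bound (inradius_has_sup V y)). Qed.

Lemma inradius_ge0 V y : 0 <= inradius V y.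
Proof.
apply: le_inradius; first by rewrite lexx ler01.
by move=> z; rewrite mballE ltNge mdist_ge0.
Qed.

Lemma inradius_ball V y (s : R) : s < inradius V y -> ball y s `<=` V.
Proof.
move=> sV; have dV : 0 < inradius V y - s by rewrite subr_gt0.
have [t [_ tV]] := sup_adherent dV (inradius_has_sup V y).
rewrite subKr => st; apply: subset_trans tV => z; rewrite !mballE; lra.
Qed.

Lemma inradius_gt0 V y : open V -> V y -> 0 < inradius V y.
Proof.
move=> /open_mdistP VV /VV[e e0 yV].
have m0 : 0 < Num.min e 1 by rewrite lt_min e0 ltr01.
apply: (lt_le_trans m0); apply: le_inradius.
  by rewrite (ltW m0) ge_min lexx orbT.
by apply: subset_trans yV => z; rewrite !mballE => /lt_le_trans; apply; rewrite ge_min lexx.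
Qed.

Lemma inradius_in V y : 0 < inradius V y -> V y.
Proof.
move=> V0; have := @inradius_ball V y (inradius V y / 2).
apply; first by lra.
by rewrite mballE mdistxx; lra.
Qed.

(** A ball of radius [t] about [y] contains the ball of radius [t - mdist y z] about [z]. Arguing by
    contradiction ensures that this radius is nonnegative. *)
Lemma inradius_lipschitz V y z : inradius V y <= inradius V z + mdist y z.
Proof.
rewrite leNgt; apply/negP => h.
pose s := inradius V z + mdist y z.
have [|t [/andP[t0 t1] tV] st] :=
  @sup_adherent R _ (inradius V y - s) _ (inradius_has_sup V y).
  by rewrite subr_gt0.
move: st; rewrite subKr => st.
suff : t - mdist y z <= inradius V z by move: st; rewrite /s; lra.
apply: le_inradius.
  have := mdist_ge0 y z; have := inradius_ge0 V z; move: st; rewrite /s; lra.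
apply: subset_trans tV => w; rewrite !mballE => zw.
have := metric_triangle y z w; lra.
Qed.

Lemma inradius_continuous V : continuous (inradius V : Y -> R).
Proof.
move=> y; apply/cvgrPdist_lt => e e0; apply/nbhs_ballP; exists e => // z.
rewrite mballE /= => yz; apply: le_lt_trans yz.
have := inradius_lipschitz V y z; have := inradius_lipschitz V z y.
rewrite /= (metric_sym z y) => *; rewrite ler_norml; lra.
Qed.

Lemma inradius_eq0 V y : ~ V y -> inradius V y = 0.
Proof.
move=> nV; apply/eqP; rewrite eq_le inradius_ge0 andbT leNgt; apply/negP.
by move/inradius_in.
Qed.

(** For [d > 0] this test function lies between the indicators of the points of depth at least [d]
    in [V] and of [V] itself, so its integrals convert weak convergence into estimates of
    measures. *)
Definition plateau V (d : R) y : R := Num.min 1 (inradius V y / d).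

Lemma plateau_continuous V d : continuous (plateau V d : Y -> R).
Proof.
move=> y; apply: (@continuous_min _ _ (cst 1 : Y -> R^o)
  (fun y => inradius V y / d : R^o)); first exact: cvg_cst.
exact: (cvgMr_tmp (@inradius_continuous V y)).
Qed.

Lemma plateau_itv V d y : 0 < d -> 0 <= plateau V d y <= 1.
Proof.
move=> d0; rewrite /plateau ge_min lexx le_min ler01.
by rewrite divr_ge0 ?inradius_ge0// ltW.
Qed.

Lemma plateau_eq1 V d y : 0 < d -> d <= inradius V y -> plateau V d y = 1.
Proof.
by move=> d0 dV; apply/min_idPl; rewrite ler_pdivlMr// mul1r.
Qed.

Lemma plateau_in V d y : 0 < d -> 0 < plateau V d y -> V y.
Proof.
move=> d0; rewrite /plateau lt_min => /andP[_].
by rewrite pmulr_lgt0 ?invr_gt0// => /inradius_in.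
Qed.

Lemma plateau_Cbbs V d (r : R) : 0 < d -> V `<=` ball point r ->
  Cbbs (plateau V d).
Proof.
move=> d0 Vr; split; first exact: plateau_continuous.
  exists 1; split=> // M M1 y _ /=.
  have /andP[p0 p1] := plateau_itv V y d0.
  by rewrite ger0_norm// (le_trans p1)// ltW.
exists r => y /= fy; apply: Vr; apply: (@plateau_in V d) => //.
by rewrite lt_neqAle eq_sym fy; case/andP: (plateau_itv V y d0).
Qed.

End metric_topology.

(** * Borel sets and the sigma-algebra of balls *)

Section borel_measure.
Context {R : realType} {Y : pmetricType R}.
Implicit Types (V : set Y) (x y z : Y).

Lemma open_bmeas V : open V -> bmeas V.
Proof. exact: sub_sigma_algebra. Qed.

Lemma mball_bmeas x (r : R) : bmeas (ball x r).
Proof. by apply: open_bmeas; exact: open_mball. Qed.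

Lemma cball_bmeas x (r : R) : bmeas (cball x r).
Proof.
rewrite -[cball x r]setCK; apply: measurableC; apply: open_bmeas.
exact: open_setC_cball.
Qed.

Lemma continuous_bmeas (f : Y -> R) : continuous f ->
  measurable_fun setT (f : borel Y -> R).
Proof.
move=> /continuousP cf.
apply: (measurability _ (RGenOpens.measurableE R)).
move=> _ [_ [a [b ->]] <-]; rewrite setTI.
by apply: open_bmeas; apply: cf; exact: interval_open.
Qed.

Lemma inradius_bmeas V (d : R) : bmeas [set y | (d <= inradius V y)%R].
Proof.
have := continuous_bmeas (@inradius_continuous _ _ V) measurableT
  (measurable_itv `[d, +oo[).
rewrite setTI (_ : _ @^-1` _ = [set y | d <= inradius V y])//.
by apply/seteqP; split => y /=; rewrite in_itv/= andbT.
Qed.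

Lemma open_lt_inradius V W : open [set y | inradius V y < inradius W y].
Proof.
apply/open_mdistP => y /= VW; exists ((inradius W y - inradius V y) / 2).
  by rewrite divr_gt0// subr_gt0.
move=> z; rewrite mballE /=.
have := inradius_lipschitz V z y; have := inradius_lipschitz W y z.
by rewrite (metric_sym z y); lra.
Qed.

(** Internal sets are represented by members of [ball_sigma]; separability allows any Borel sets
    there. *)
Lemma bmeas_ball_sigma V : polish Y -> bmeas V -> ball_sigma V.
Proof.
move=> /dense_seq[u ud]; move: V; apply: smallest_sub.
  exact: smallest_sigma_algebra.
move=> U oU.
pose B n k := if `[< ball (u n) (k.+1%:R^-1 : R) `<=` U >]
  then ball (u n) (k.+1%:R^-1 : R) else set0.
have -> : U = \bigcup_n \bigcup_k B n k.
  rewrite eqEsubset; split.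
    move=> x Ux; have [n [k [nkU nkx]]] := dense_seq_ball oU Ux ud.
    by exists n => //; exists k => //; rewrite /B; case: asboolP.
  by move=> x [n _ [k _]]; rewrite /B; case: asboolP => // + xB; exact.
pose T := g_sigma_algebraType [set A : set Y | exists x (r : R), A = ball x r].
apply: (@bigcupT_measurable _ T) => n; apply: bigcupT_measurable => k.
rewrite /B; case: asboolP => // _.
by apply: sub_sigma_algebra; exists (u n), k.+1%:R^-1.
Qed.

Lemma ball_sigma_bmeas V : ball_sigma V -> bmeas V.
Proof.
move: V; apply: smallest_sub; first exact: smallest_sigma_algebra.
by move=> _ [x [r ->]]; exact: mball_bmeas.
Qed.

End borel_measure.

(** * Continuity and regularity of Borel measures *)

Section ereal_limits.
Context {R : realType} {T : Type} {F : set_system T} {FF : Filter F}.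
Implicit Types (u : T -> \bar R) (l c : \bar R).

Lemma cvge_lt u l c : u @ F --> l -> (l < c)%E -> \forall i \near F, (u i < c)%E.
Proof. by move=> ul lc; exact: (ul _ (open_ereal_lt' lc)). Qed.

Lemma cvge_gt u l c : u @ F --> l -> (c < l)%E -> \forall i \near F, (c < u i)%E.
Proof. by move=> ul lc; exact: (ul _ (open_ereal_gt' lc)). Qed.

End ereal_limits.

Section measure_continuity.
Context d {T : measurableType d} {R : realType} (mu : {measure set T -> \bar R}).
Implicit Types F : (set T)^nat.

Lemma lt_measure_bigcup F (a : \bar R) :
  (forall n, measurable (F n)) -> nondecreasing_seq F ->
  (a < mu (\bigcup_n F n))%E -> exists n, (a < mu (F n))%E.
Proof.
move=> mF ndF; apply: contraPP => /forallNP Fa; apply/negP; rewrite -leNgt.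
have cF := @nondecreasing_cvg_mu _ _ _ mu F mF (bigcupT_measurable _ mF) ndF.
apply: (cvge_le _ cF); apply: nearW => n /=.
by rewrite leNgt; apply/negP/Fa.
Qed.

Lemma measure_bigcap_lt F (c : \bar R) :
  (forall n, measurable (F n)) -> nonincreasing_seq F -> (mu (F 0%N) < +oo)%E ->
  (mu (\bigcap_n F n) < c)%E -> exists n, (mu (F n) < c)%E.
Proof.
move=> mF niF F0; apply: contraPP => /forallNP Fa; apply/negP; rewrite -leNgt.
have cF := @nonincreasing_cvg_mu _ _ _ mu F F0 mF (bigcapT_measurable mF) niF.
apply: (cvge_ge _ cF); apply: nearW => n /=.
by rewrite leNgt; apply/negP/Fa.
Qed.

Lemma measure_bigcup_le_pow F (e : R) : (forall n, measurable (F n)) -> 0 <= e ->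
  (forall n, (mu (F n) <= (e / (2 ^ n.+1)%:R)%:E)%E) ->
  (mu (\bigcup_n F n) <= e%:E)%E.
Proof.
move=> mF e0 Fe; apply: le_trans (epsilon_trick0 xpredT e0).
apply: le_trans (generalized_Boole_inequality _ mF (bigcupT_measurable _ mF)) _.
by apply: lee_nneseries => // n _; exact: Fe.
Qed.

End measure_continuity.

Section borel_regularity.
Context {R : realType} {Y : pmetricType R} (mu : {measure set (borel Y) -> \bar R}).

(** The complement of [U'] is a closed inner approximation of [C], and [U] meets [U'] exactly in the
    gap between the two approximations. With two open sets, passing to the complement of [C] is a
    mere swap. *)
Definition regular_on (W C : set Y) := forall e : R, 0 < e ->
  exists U U' : set Y, [/\ open U, open U', C `<=` U, ~` C `<=` U' &
    (mu (U `&` U' `&` W) < e%:E)%E].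

Lemma open_regular (W C : set Y) : bmeas W -> (mu W < +oo)%E -> open C ->
  regular_on W C.
Proof.
move=> mW Woo oC e e0.
(* Since [C] is open, these thickenings of its complement have traces on [C] that decrease to the
   empty set. *)
pose U' n := \bigcup_(y in ~` C) ball y (n.+1%:R^-1 : R).
have oU' n : open (U' n) by apply: bigcup_open => y _; exact: open_mball.
pose F n : set Y := C `&` U' n `&` W.
have mF n : bmeas (F n).
  by apply: measurableI => //; apply: measurableI; exact: open_bmeas.
have niF : nonincreasing_seq (F : nat -> set (borel Y)).
  move=> n k nk; apply/subsetPset; apply: setSI; apply: setIS => y [z Cz] /=.
  rewrite mballE => zy; exists z => //; rewrite mballE (lt_le_trans zy)//.
  by rewrite lef_pV2 ?posrE// ler_nat.
have F0 : (mu (F 0%N) < +oo)%E.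
  by apply: le_lt_trans Woo; apply: le_measure; rewrite ?inE//; exact: subIsetr.
have [|n Fn] := @measure_bigcap_lt _ _ _ mu F e%:E mF niF F0.
  rewrite (_ : \bigcap_n F n = set0) ?measure0// -subset0 => y Fy.
  have [[Cy _] _] := Fy 0%N I.
  have /open_mdistP/(_ y Cy)[d d0 yd] := oC.
  have [k] := ltr_add_invr d0; rewrite add0r => kd.
  have [[_ [z Cz /=]] + _] := Fy k I; rewrite mballE => zy.
  by apply: Cz; apply: yd; rewrite mballE metric_sym (lt_trans zy).
exists C, (U' n); split => // y Cy; exists y => //. rewrite /=.
by rewrite mballE mdistxx invr_gt0.
Qed.

Lemma bmeas_regular (W C : set Y) : bmeas W -> (mu W < +oo)%E -> bmeas C ->
  regular_on W C.
Proof.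
move=> mW Woo; move: C; apply: smallest_sub; last first.
  by move=> C oC; exact: open_regular.
split.
- exact/open_regular/open0.
- move=> C rC e /rC[U [U' [oU oU' CU CU' UU']]].
  exists U', U; split; rewrite ?setTD ?setCK//.
  by rewrite (setIC U').
- move=> C rC e e0.
  have e20 : 0 < e / 2 by rewrite divr_gt0.
  have : forall n, exists UU' : set Y * set Y, [/\ open UU'.1, open UU'.2,
     C n `<=` UU'.1, ~` (C n) `<=` UU'.2 &
     (mu (UU'.1 `&` UU'.2 `&` W) < (e / 2 / (2 ^ n.+1)%:R)%:E)%E].
    move=> n; have e2n : 0 < e / 2 / (2 ^ n.+1)%:R by rewrite divr_gt0// ltr0n expn_gt0.
    by have [U [U' ?]] := rC n _ e2n; exists (U, U').
  move=> /choice[UU UUP].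
  pose U := \bigcup_n (UU n).1.
  (* Only finite intersections are sure to be open. The error made by stopping at [N] tends to that
     of the full intersection, by continuity from above on the finite measure of [W]. *)
  pose V N := \bigcap_(n in `I_N) (UU n).2.
  have oU : open U by apply: bigcup_open => n _; case: (UUP n).
  have oV N : open (V N).
    rewrite /V bigcap_mkord; elim/big_ind: _ => //; first exact: openT.
    + exact: openI.
    + by move=> n _; case: (UUP n).
  pose F N : set Y := U `&` V N `&` W.
  have mF n : bmeas (F n).
    by apply: measurableI => //; apply: measurableI; exact: open_bmeas.
  have niF : nonincreasing_seq (F : nat -> set (borel Y)).
    move=> n k nk; apply/subsetPset; apply: setSI; apply: setIS => y Vy j /= jn.
    by apply: Vy => /=; rewrite (leq_trans jn).
  have F0 : (mu (F 0%N) < +oo)%E.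
    by apply: le_lt_trans Woo; apply: le_measure; rewrite ?inE//; exact: subIsetr.
  pose G n : set Y := (UU n).1 `&` (UU n).2 `&` W.
  have mG n : bmeas (G n).
    by apply: measurableI => //; apply: measurableI; apply: open_bmeas; case: (UUP n).
  have [|n Fn] := @measure_bigcap_lt _ _ _ mu F e%:E mF niF F0.
    apply: (@le_lt_trans _ _ (mu (\bigcup_n G n))).
      apply: le_measure; rewrite ?inE.
      - exact: bigcapT_measurable.
      - exact: bigcupT_measurable.
      - move=> y Fy; have [[[n _ Uy] _] Wy] := Fy 0%N I; exists n => //.
        (* The bound [n.+1] is the first one whose intersection includes the index [n]. *)
        split => //; split => //; have [[_ Vy] _] := Fy n.+1 I; exact: Vy (ltnSn n).
    apply: (@le_lt_trans _ _ (e / 2)%:E).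
      apply: measure_bigcup_le_pow => //; first exact: ltW.
      by move=> n; apply: ltW; case: (UUP n).
    by rewrite lte_fin; lra.
  exists U, (V n); split => //.
    by move=> y [k _ Cy]; exists k => //; case: (UUP k) => _ _ /(_ y Cy).
  move=> y Cy k _; case: (UUP k) => _ _ _ CU _; apply: CU => Cky.
  by apply: Cy; exists k.
Qed.

Lemma open_setC_spt : open (~` spt mu).
Proof.
apply/open_mdistP => y /existsNP[r /not_implyP[r0 /negP]]; rewrite -leNgt => yr.
exists (r / 2); first by rewrite divr_gt0.
move=> z; rewrite mballE => yz /(_ (r / 2)); rewrite divr_gt0// => /(_ isT).
apply/negP; rewrite -leNgt; apply: le_trans yr.
apply: le_measure; rewrite ?inE; [exact: mball_bmeas..|].
move=> w; rewrite !mballE => zw; have := metric_triangle y z w; lra.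
Qed.

Lemma measure_setC_spt : polish Y -> mu (~` spt mu) = 0%E.
Proof.
move=> /dense_seq[u ud].
pose B n k : set Y := if mu (ball (u n) (k.+1%:R^-1 : R)) == 0%E
  then ball (u n) (k.+1%:R^-1 : R) else set0.
have mB n k : bmeas (B n k) by rewrite /B; case: ifP => // _; exact: mball_bmeas.
have mBn n : bmeas (\bigcup_k B n k) by exact: bigcupT_measurable.
have B0 n k : mu (B n k) = 0%E by rewrite /B; case: ifP => [/eqP//|_]; exact: measure0.
apply: (@subset_measure0 _ _ _ mu _ (\bigcup_n \bigcup_k B n k)).
- by apply: open_bmeas; exact: open_setC_spt.
- exact: bigcupT_measurable.
- move=> y sy.
  have := sy => /existsNP[r /not_implyP[r0 /negP]]; rewrite -leNgt => yr.
  have yr' : ball y r y by rewrite mballE mdistxx.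
  have [n [k [nky nk]]] := dense_seq_ball (open_mball y r) yr' ud.
  exists n => //; exists k => //; rewrite /B ifT// -measure_le0.
  apply: le_trans yr; apply: le_measure; rewrite ?inE //; exact: mball_bmeas.
- have B00 n : mu (\bigcup_k B n k) = 0%E.
    apply/eqP; rewrite -measure_le0.
    apply: le_trans (generalized_Boole_inequality _ (mB n) (mBn n)) _.
    by rewrite eseries0.
  apply/eqP; rewrite -measure_le0.
  apply: le_trans (generalized_Boole_inequality _ mBn (bigcupT_measurable _ mBn)) _.
  by rewrite eseries0.
Qed.

End borel_regularity.

(** * Ultralimits and internal sets *)

Section nonprincipal_ultrafilter.
Context {R : realType} {omega : set_system nat} (ultra : UltraFilter omega)
  (nonprincipal : forall n, omega <> principal_filter n).

(** An ultrafilter that contains a singleton is principal, so [omega] contains the complements of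
    all singletons, hence all cofinite sets. *)
Lemma eventually_ultra (P : set nat) : (\forall i \near \oo, P i) -> omega P.
Proof.
have omegaC n : omega (~` [set n]).
  have [on|//] := in_ultra_setVsetC [set n] ultra.
  exfalso; apply: (nonprincipal (n := n)); apply/seteqP; split => A.
    move=> oA; apply/principal_filterP.
    by have [k [Ak <-]] := filter_ex (filterI oA on).
  by move/principal_filterP => An; apply: filterS on => _ ->.
move=> [N _ NP]; apply: filterS NP _; elim: N => [|N IH].
  exact: filterS filterT.
apply: filterS2 IH (omegaC N) => k /= Nk /eqP kN.
by rewrite ltn_neqAle eq_sym kN.
Qed.

(* The elementary form of the countable saturation of ultraproducts. *)
Lemma ultra_diagonal (Q : nat -> nat -> Prop) :
  (forall n, \forall i \near omega, Q n i) ->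
  exists k : nat -> nat, (forall n, \forall i \near omega, (n <= k i)%N) /\
    \forall i \near omega, Q (k i) i.
Proof.
move=> Qo.
(* The witness is the largest [n <= i] with [Q n i], and 0 if there is none; in either case [Q 0 i]
   implies [Q (k i) i]. *)
have /choice[k kP] : forall i, exists k,
    (Q 0 i -> Q k i) /\ forall n, (n <= i)%N -> Q n i -> (n <= k)%N.
  move=> i.
  suff H N : exists k, (Q 0 i -> Q k i) /\ forall n, (n <= N)%N -> Q n i -> (n <= k)%N.
    exact: H.
  elim: N => [|N [k [k0 kP]]].
    by exists 0%N; split => // n; rewrite leqn0 => /eqP ->.
  have [QN|QN] := pselect (Q N.+1 i).
    by exists N.+1; split.
  exists k; split => // n; rewrite leq_eqVlt => /predU1P[-> //|].
  by rewrite ltnS => nN; exact: kP.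
exists k; split=> [n|].
  have ni : \forall i \near omega, (n <= i)%N by apply: eventually_ultra; exists n.
  by apply: filterS2 ni (Qo n) => i; exact: (kP i).2.
by apply: filterS (Qo 0%N) => i; exact: (kP i).1.
Qed.

Lemma ultra_cvge (u : nat -> \bar R) : (forall i, (0 <= u i)%E) ->
  u @ omega --> lim (u @ omega).
Proof.
move=> u0; have [uoo|ufin] := in_ultra_setVsetC [set i | u i = +oo%E] ultra.
  apply/cvg_ex; exists +oo%E; apply: cvg_near_cst.
  by apply: filterS uoo.
have fu0 i : 0 <= fine (u i) by exact: fine_ge0.
have /cvg_ex[l ul] := ultra_cvg_ge0 ultra fu0.
apply/cvg_ex; exists l; apply: cvg_trans ul; apply: near_eq_cvg.
apply: filterS ufin => i /= ui; rewrite fineK// ge0_fin_numE// ltey.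
exact/eqP.
Qed.

Lemma ultra_lim_le (u : nat -> \bar R) (c : \bar R) : (forall i, (0 <= u i)%E) ->
  (\forall i \near omega, (u i <= c)%E) -> (lim (u @ omega) <= c)%E.
Proof. by move=> u0 uc; exact: cvge_le uc (ultra_cvge u0). Qed.

Lemma ultra_lim_ge (u : nat -> \bar R) (c : \bar R) : (forall i, (0 <= u i)%E) ->
  (\forall i \near omega, (c <= u i)%E) -> (c <= lim (u @ omega))%E.
Proof. by move=> u0 uc; exact: cvge_ge uc (ultra_cvge u0). Qed.

Lemma ultra_lim_lt (u : nat -> \bar R) (c : \bar R) : (forall i, (0 <= u i)%E) ->
  (lim (u @ omega) < c)%E -> \forall i \near omega, (u i < c)%E.
Proof.
move=> u0 uc; have [//|cu] := in_ultra_setVsetC [set i | (u i < c)%E] ultra.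
move: uc; rewrite ltNge => /negP; case; apply: ultra_lim_ge => //.
by apply: filterS cu => i /negP; rewrite -leNgt.
Qed.

End nonprincipal_ultrafilter.

(** * Outer content and null sets in the ultraproduct *)

Section loeb.
Context {R : realType} {omega : set_system nat} (ultra : UltraFilter omega)
  (nonprincipal : forall n, omega <> principal_filter n)
  {X : nat -> pmetricType R}
  (m : forall i, {measure set (borel (X i)) -> \bar R})
  (X_polish : forall i, polish (X i)).
Notation OX := (OX ultra X).
Notation internal := (internal (ultra := ultra)).

Definition repr_family (x : OX) i : X i := repr (val x) i.

Definition family_class (x : forall i, X i) : Xbar ultra X :=
  (\pi_{eq_quot (ae_eq_fam_equiv ultra X)} x)%qT.

Lemma repr_family_class (x : forall i, X i) :
  \forall i \near omega, repr (family_class x) i = x i.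
Proof.
have : (repr (family_class x) = x %[mod {eq_quot (ae_eq_fam_equiv ultra X)}])%qT.
  by rewrite reprK.
by move/eqmodP => /asboolP.
Qed.

Lemma OX_repr_family (x : forall i, X i) (r : R) :
  (\forall i \near omega, mdist point (x i) <= r) ->
  exists z : OX, \forall i \near omega, repr_family z i = x i.
Proof.
move=> xr; have xO : Obar (family_class x).
  apply: (@le_lt_trans _ _ r%:E); last exact: ltry.
  apply: ultra_lim_le => [i|]; first by rewrite lee_fin mdist_ge0.
  apply: filterS3 xr (repr_family_class x) (repr_family_class (fun=> point)) => i xr -> ->.
  by rewrite lee_fin metric_sym.
pose z : OX := exist _ (family_class x) (mem_set xO).
by exists z; exact: repr_family_class.
Qed.

Lemma OX_bounded (x : OX) :
  exists n : nat, \forall i \near omega, ball point (n%:R : R) (repr_family x i).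
Proof.
have xoo : (dbar (val x) (pbar ultra X) < +oo)%E by exact: (set_valP x).
pose n := (Num.truncn (fine (dbar (val x) (pbar ultra X)))).+1.
have xn : (dbar (val x) (pbar ultra X) < n%:R%:E)%E.
  by rewrite -[dbar _ _]fineK ?ge0_fin_numE ?dbar_ge0// lte_fin truncnS_gt.
exists n.
have u0 i : (0 <= (mdist (repr_family x i) (repr (pbar ultra X) i))%:E)%E.
  by rewrite lee_fin mdist_ge0.
have pE : \forall i \near omega, repr (pbar ultra X) i = point.
  exact: repr_family_class.
by apply: filterS2 (ultra_lim_lt ultra u0 xn) pE => i + pi; rewrite pi lte_fin mballE metric_sym.
Qed.

(** Counterexamples chosen in each coordinate would form a point of [OX] that violates the
    inclusion. The ball keeps this family at finite distance from the base point; unbounded families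
    define no point of [OX]. *)
Lemma internal_subset (A B : forall i, set (X i)) :
  internal A `<=` internal B ->
  forall r : R, \forall i \near omega, A i `&` ball point r `<=` B i.
Proof.
move=> AB r.
have [//|nAB] := in_ultra_setVsetC [set i | A i `&` ball point r `<=` B i] ultra.
pose x i : X i := xget point [set x | (A i `&` ball point r) x /\ ~ B i x].
have xP i : ~ (A i `&` ball point r `<=` B i) ->
    (A i `&` ball point r) (x i) /\ ~ B i (x i).
  move/existsNP => [y /not_implyP yAB]; rewrite /x.
  by case: xgetP => [z _ //|/(_ y)[]].
have [z zx] : exists z : OX, \forall i \near omega, repr_family z i = x i.
  apply: (@OX_repr_family x r); apply: filterS nAB => i /xP[[_]].
  by rewrite mballE => /ltW.
have zA : internal A z.
  by apply: filterS2 zx nAB => i xi /xP[[Ax _] _]; rewrite -[repr _ _]/(repr_family z i) xi.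
have [i [Bz [xi /xP[_]]]] := filter_ex (filterI (AB _ zA) (filterI zx nAB)).
by rewrite -xi.
Qed.

Definition family_bmeas (A : forall i, set (X i)) := forall i, bmeas (A i).

(* Outer content at most [c]; intersecting with balls spares the limit in the
   radius that defines [internal_measure]. *)
Definition small (N : set OX) (c : R) := exists A : forall i, set (X i),
  [/\ family_bmeas A, N `<=` internal A & forall r : R,
    \forall i \near omega, (m i (A i `&` ball point r) <= c%:E)%E].

Lemma internal_algebra_rep B : internal_algebra B ->
  internal_rep B (xget (fun=> set0) (@internal_rep _ _ ultra X B)).
Proof. exact: xgetPex. Qed.

Let mball_lim (A : forall i, set (X i)) r : \bar R :=
  lim (m i (A i `&` ball point r) @[i --> omega]).

Let mball_lim_cvg (A : forall i, set (X i)) : family_bmeas A ->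
  mball_lim A r @[r --> +oo] --> ereal_sup (range (mball_lim A)).
Proof.
move=> mA; apply: nondecreasing_cvge => r s rs.
have mAr i t : bmeas (A i `&` ball point t).
  by apply: measurableI => //; exact: mball_bmeas.
apply: lee_lim; [exact: ultra_cvge..|apply: nearW => i].
apply: le_measure; rewrite ?inE//; apply: setIS => x; rewrite !mballE.
by move=> /lt_le_trans; apply.
Qed.

Let internal_rep_bmeas B A : internal_rep B A -> family_bmeas A.
Proof. by move=> [sA _] i; exact: ball_sigma_bmeas. Qed.

Let internal_measureE B : internal_algebra B -> internal_measure m B =
  ereal_sup (range (mball_lim (xget (fun=> set0) (@internal_rep _ _ ultra X B)))).
Proof.
move=> /internal_algebra_rep/internal_rep_bmeas/mball_lim_cvg/cvg_lim.
exact.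
Qed.

Lemma internal_internal_algebra (A : forall i, set (X i)) :
  family_bmeas A -> @internal_algebra _ _ ultra X (internal A).
Proof. by move=> mA; exists A; split => // i; exact: bmeas_ball_sigma. Qed.

(** The measure is computed on an arbitrarily chosen representative, which [internal_subset]
    compares with the cover; independence of the choice is thereby bypassed. *)
Lemma internal_measure_le B (c : R) : internal_algebra B -> small B c ->
  (internal_measure m B <= c%:E)%E.
Proof.
move=> iB [E [mE BE Ec]]; rewrite internal_measureE//.
have := internal_algebra_rep iB; set A := xget _ _ => rA.
have mA := internal_rep_bmeas rA; apply: ge_ereal_sup => _ [r _ <-].
apply: ultra_lim_le => [//|].
have AE : internal A `<=` internal E by rewrite rA.2.
apply: filterS2 (Ec r) (internal_subset AE r) => i + AEi; apply: le_trans.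
have ? : bmeas (ball (point : X i) r) by exact: mball_bmeas.
apply: le_measure; rewrite ?inE; [exact: measurableI..|].
by move=> x Ax; split; [exact: AEi|case: Ax].
Qed.

(** The uniform bound on [H] makes its whole mass visible at radius [r]; mass escaping to infinity
    would not be counted by [internal_measure]. *)
Lemma le_internal_measure B H (a c r : R) : internal_algebra B -> family_bmeas H ->
  small (internal H `\` B) c ->
  (\forall i \near omega, H i `<=` ball point r) ->
  (\forall i \near omega, (a%:E <= m i (H i))%E) ->
  (a%:E <= internal_measure m B + c%:E)%E.
Proof.
move=> iB mH [E [mE HBE Ec]] Hr aH; rewrite internal_measureE//.
have := internal_algebra_rep iB; set A := xget _ _ => rA.
have mA := internal_rep_bmeas rA.
have HAE : internal H `<=` internal (fun i => A i `|` E i).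
  move=> x Hx; have [Bx|nBx] := pselect (B x).
    by move: Bx; rewrite -rA.2; apply: filterS => i; left.
  by apply: filterS (HBE x (conj Hx nBx)) => i; right.
rewrite -leeBlDr//; apply: (@le_trans _ _ (mball_lim A r)); last first.
  by apply: ereal_sup_ubound; exists r.
apply: ultra_lim_ge => [//|].
apply: filterS3 (filterI aH Hr) (Ec r) (internal_subset HAE r).
move=> i [aHi Hri] Eci HAEi; rewrite leeBlDr//.
have ? : bmeas (ball (point : X i) r) by exact: mball_bmeas.
have mAr : bmeas (A i `&` ball point r) by exact: measurableI.
have mEr : bmeas (E i `&` ball point r) by exact: measurableI.
apply: (le_trans aHi).
apply: (@le_trans _ _ (m i (A i `&` ball point r `|` E i `&` ball point r))).
  apply: le_measure; rewrite ?inE//; first exact: measurableU.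
  move=> x Hx; have rx := Hri x Hx.
  by case: (HAEi x (conj Hx rx)) => ?; [left|right].
by apply: (le_trans (measureU2 (m i) mAr mEr)); exact: leeD.
Qed.

Lemma null_small N : null m N <-> forall e : R, 0 < e -> small N e.
Proof.
split=> [nN e /nN[B [iB NB Be]]|sN e e0].
  have := Be; rewrite internal_measureE//.
  have := internal_algebra_rep iB; set A := xget _ _ => rA Ae.
  exists A; split; [exact: internal_rep_bmeas rA|by rewrite rA.2|move=> r].
  have : (mball_lim A r < e%:E)%E.
    by apply: le_lt_trans Ae; apply: ereal_sup_ubound; exists r.
  by move/(ultra_lim_lt ultra) => Are; apply: filterS (Are _) => // i /ltW.
have [|E [mE NE Ee]] := sN (e / 2); first by rewrite divr_gt0.
exists (internal E); split => //; first exact: internal_internal_algebra.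
apply: (@le_lt_trans _ _ (e / 2)%:E); last by rewrite lte_fin; lra.
apply: internal_measure_le; first exact: internal_internal_algebra.
by exists E; split.
Qed.

Lemma small_subset N N' c : N `<=` N' -> small N' c -> small N c.
Proof. by move=> NN [E [mE NE Ec]]; exists E; split => //; exact: subset_trans NE. Qed.

Lemma null_subset N N' : N `<=` N' -> null m N' -> null m N.
Proof. by move=> NN /null_small sN; apply/null_small => e /sN; exact: small_subset. Qed.

Lemma smallU N N' c c' : small N c -> small N' c' -> small (N `|` N') (c + c').
Proof.
move=> [E [mE NE Ec]] [E' [mE' NE' Ec']]; exists (fun i => E i `|` E' i); split.
- by move=> i; exact: measurableU.
- move=> x [/NE|/NE']; first by apply: filterS => i; left.
  by apply: filterS => i; right.
- move=> r; apply: filterS2 (Ec r) (Ec' r) => i Eci Ec'i.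
  have ? : bmeas (ball (point : X i) r) by exact: mball_bmeas.
  rewrite setIUl (le_trans (measureU2 _ _ _))//; [exact: measurableI..|].
  by rewrite EFinD leeD.
Qed.

Lemma nullU N N' : null m N -> null m N' -> null m (N `|` N').
Proof.
move=> /null_small sN /null_small sN'; apply/null_small => e e0.
by rewrite [e]splitr; apply: smallU; [apply: sN|apply: sN']; rewrite divr_gt0.
Qed.

(** A union of internal sets need not be internal, but the diagonal family [A (k i) i] covers each
    of them, as [k i] exceeds every integer along [omega]. Cutting it at radius [k i] keeps the
    bound [c] and loses no point of [OX], since each point is bounded. *)
Lemma small_nondecreasing_bigcup (A : nat -> forall i, set (X i)) (c : R) :
  (forall n, family_bmeas (A n)) ->
  (forall n k i, (n <= k)%N -> A n i `<=` A k i) ->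
  (forall n (r : R), \forall i \near omega, (m i (A n i `&` ball point r) <= c%:E)%E) ->
  small (\bigcup_n internal (A n)) c.
Proof.
move=> mA ndA Ac.
have [k [kn kc]] := ultra_diagonal ultra nonprincipal (fun n => Ac n n%:R).
exists (fun i => A (k i) i `&` ball point (k i)%:R); split.
- by move=> i; apply: measurableI; [exact: mA|exact: mball_bmeas].
- move=> x [n _ Ax]; have [l xl] := OX_bounded x.
  apply: filterS3 Ax xl (filterI (kn n) (kn l)) => i Axi xli [nk lk].
  split; first exact: ndA Axi.
  by move: xli; rewrite !mballE => /lt_le_trans; apply; rewrite ler_nat.
- move=> r; apply: filterS kc => i; apply: le_trans.
  have ? : bmeas (ball (point : X i) (k i)%:R) by exact: mball_bmeas.
  have ? : bmeas (ball (point : X i) r) by exact: mball_bmeas.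
  have ? : bmeas (A (k i) i `&` ball point (k i)%:R).
    by apply: measurableI => //; exact: mA.
  by apply: le_measure; rewrite ?inE; [exact: measurableI|by []|exact: subIsetl].
Qed.

Lemma small_bigcup (N : nat -> set OX) (e : R) : 0 <= e ->
  (forall n, small (N n) (e / (2 ^ n.+1)%:R)) -> small (\bigcup_n N n) e.
Proof.
move=> e0 /choice[E sE].
pose A n i := \bigcup_(k in `I_n.+1) E k i.
apply: (@small_subset _ (\bigcup_n internal (A n))).
  move=> x [n _ Nx]; exists n => //; have [_ /(_ x Nx) Ex _] := sE n.
  by apply: filterS Ex => i Exi; exists n => /=.
have mA n : family_bmeas (A n).
  by move=> i; apply: bigcup_measurable => k _; case: (sE k).
apply: small_nondecreasing_bigcup => //.
- by move=> n k i nk x [l /= ln Ex]; exists l => //=; rewrite (leq_trans ln).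
move=> n r; have : \forall i \near omega,
    (m i (A n i `&` ball point r) <= \sum_(k < n.+1) (e / (2 ^ k.+1)%:R)%:E)%E.
  elim: n => [|n IH].
    have [_ _ /(_ r)] := sE 0%N; apply: filterS => i.
    by rewrite big_ord1 /A II1 bigcup_set1.
  have [_ _ /(_ r)] := sE n.+1; apply: filterS2 IH => i IH En.
  have ? : bmeas (ball (point : X i) r) by exact: mball_bmeas.
  rewrite big_ord_recr/= /A (IIS n.+1) bigcup_setU bigcup_set1 setIUl.
  have ? : bmeas (E n.+1 i) by case: (sE n.+1).
  rewrite (le_trans (measureU2 _ _ _))//; [|exact: measurableI|exact: leeD].
  by apply: measurableI => //; exact: mA.
apply: filterS => i /le_trans; apply.
apply: le_trans (epsilon_trick0 xpredT e0).
rewrite -(big_mkord xpredT (fun k => (e / (2 ^ k.+1)%:R)%:E)).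
by apply: nneseries_lim_ge => k _ _; rewrite lee_fin divr_ge0// ler0n.
Qed.

Lemma null_bigcup (N : nat -> set OX) :
  (forall n, null m (N n)) -> null m (\bigcup_n N n).
Proof.
move=> nN; apply/null_small => e e0; apply: small_bigcup => [|n]; first exact: ltW.
by have /null_small := nN n; apply; rewrite divr_gt0// ltr0n expn_gt0.
Qed.

End loeb.

(** * Exact internal approximations by saturation *)

Section saturation.
Context {R : realType} {omega : set_system nat} (ultra : UltraFilter omega)
  (nonprincipal : forall n, omega <> principal_filter n)
  {X : nat -> pmetricType R}
  (m : forall i, {measure set (borel (X i)) -> \bar R})
  (X_polish : forall i, polish (X i)).
Notation OX := (OX ultra X).
Notation internal := (internal (ultra := ultra)).

Lemma internalC (A : forall i, set (X i)) (x : OX) :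
  ~ internal A x -> internal (fun i => ~` A i) x.
Proof. by move=> nA; have [] := in_ultra_setVsetC [set i | A i (repr_family x i)] ultra. Qed.

Lemma near_forall_le (P : nat -> nat -> Prop) n :
  (forall j, \forall i \near omega, P j i) ->
  \forall i \near omega, forall j, (j <= n)%N -> P j i.
Proof.
move=> Po; elim: n => [|n IH].
  by apply: filterS (Po 0%N) => i Pi j; rewrite leqn0 => /eqP ->.
apply: filterS2 IH (Po n.+1) => i Pi Pn j.
by rewrite leq_eqVlt => /predU1P[-> //|]; rewrite ltnS => /Pi.
Qed.

(* [D] need not be internal: the internal families approximating it up to [e]
   are glued along a diagonal. *)
Lemma internal_saturation (D : set OX) :
  (forall e : R, 0 < e -> exists A : forall i, set (X i),
    family_bmeas A /\ small m (D `+` internal A) e) ->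
  exists A : forall i, set (X i), family_bmeas A /\ null m (D `+` internal A).
Proof.
move=> De.
have : forall n, exists AE : (forall i, set (X i)) * (forall i, set (X i)),
    [/\ family_bmeas AE.1, family_bmeas AE.2, D `+` internal AE.1 `<=` internal AE.2 &
     forall r : R, \forall i \near omega,
       (m i (AE.2 i `&` ball point r) <= (n.+1%:R^-1 : R)%:E)%E].
  move=> n; have [|A [mA [E [mE DE Ee]]]] := De n.+1%:R^-1; first by rewrite invr_gt0.
  by exists (A, E).
move=> /choice[AE AEP].
pose A n := (AE n).1; pose E n := (AE n).2.
have mA n : family_bmeas (A n) by case: (AEP n).
have mE n : family_bmeas (E n) by case: (AEP n).
have DE n : D `+` internal (A n) `<=` internal (E n) by case: (AEP n).
have Ee n (r : R) : \forall i \near omega,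
    (m i (E n i `&` ball point r) <= (n.+1%:R^-1 : R)%:E)%E.
  by case: (AEP n).
(* Off both error sets [A j] and [A n] agree with [D], hence with each other. Their comparison no
   longer involves [D], so it descends to the coordinates. *)
have AjAn j n (r : R) : \forall i \near omega,
    (A j i `+` A n i) `&` ball point r `<=` E j i `|` E n i.
  apply: (internal_subset (ultra := ultra) (A := fun i => A j i `+` A n i)
    (B := fun i => E j i `|` E n i)) => x Ax.
  have [Ejx|nEj] := pselect (internal (E j) x); first by apply: filterS Ejx => i; left.
  have [Enx|nEn] := pselect (internal (E n) x); first by apply: filterS Enx => i; right.
  have DA k : ~ internal (E k) x -> (D x <-> internal (A k) x).
    move=> nEk; split=> [Dx|Akx]; apply: contrapT => h; apply/nEk/DE; first by left.
    by right.
  exfalso; have [Dx|nDx] := pselect (D x).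
    have [i [[[_ ?]|[_ ?]] []]] //:= filter_ex (filterI Ax
      (filterI ((DA j nEj).1 Dx) ((DA n nEn).1 Dx))).
  have nAj : internal (fun i => ~` A j i) x by apply: internalC => /(DA j nEj).2.
  have nAn : internal (fun i => ~` A n i) x by apply: internalC => /(DA n nEn).2.
  by have [i [[[? _]|[? _]] []]] := filter_ex (filterI Ax (filterI nAj nAn)).
(* All comparisons with [j <= n] are included, so that the diagonal family can be compared with
   every fixed [A j]. *)
pose Q n i := (forall j, (j <= n)%N ->
    (A j i `+` A n i) `&` ball point (n%:R : R) `<=` E j i `|` E n i) /\
  (m i (E n i `&` ball point (n%:R : R)) <= (n.+1%:R^-1 : R)%:E)%E.
have QP n : \forall i \near omega, Q n i.
  apply: filterS2 (near_forall_le n (fun j => AjAn j n n%:R)) (Ee n n%:R) => i.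
  by split.
have [k [kn kQ]] := ultra_diagonal ultra nonprincipal QP.
exists (fun i => A (k i) i); split; first by move=> i; exact: mA.
apply/null_small => // e e0.
have e20 : 0 < e / 2 by rewrite divr_gt0.
have [j] := ltr_add_invr e20; rewrite add0r => je.
(* A fixed [E j] controls the passage from [D] to [A j], and the diagonal error set controls that
   from [A j] to [A (k i)]. Each costs at most [e / 2], because [k i] eventually exceeds [j]. *)
exists (fun i => E j i `|` (E (k i) i `&` ball point (k i)%:R)); split.
- by move=> i; apply: measurableU; [exact: mE|apply: measurableI; [exact: mE|exact: mball_bmeas]].
- move=> x xDB.
  have [Ejx|nEj] := pselect (internal (E j) x); first by apply: filterS Ejx => i; left.
  have [n xn] := OX_bounded x.
  suff xA : internal (fun i => A j i `+` A (k i) i) x.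
    have xk : \forall i \near omega, [/\ Q (k i) i, (j <= k i)%N & (n <= k i)%N].
      by apply: filterS3 kQ (kn j) (kn n) => i; split.
    apply: filterS3 xA xn xk => i xAi xni [[Qi _] jk nk].
    have xki : ball point (k i)%:R (repr_family x i).
      by move: xni; rewrite !mballE => /lt_le_trans; apply; rewrite ler_nat.
    by have [?|?] := Qi j jk _ (conj xAi xki); [left|right].
  case: xDB => -[].
    move=> Dx /internalC Bx.
    have Ax : internal (A j) x by apply: contrapT => h; apply/nEj/DE; left.
    by apply: filterS2 Ax Bx => i; left.
  move=> Bx nDx.
  have /internalC Ax : ~ internal (A j) x by move=> h; apply/nEj/DE; right.
  by apply: filterS2 Ax Bx => i; right.
- move=> r; apply: filterS3 kQ (kn j) (Ee j r) => i [_ Eki] jk Eji.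
  have ? : bmeas (ball (point : X i) r) by exact: mball_bmeas.
  have ? : bmeas (E j i) by exact: mE.
  have mEk : bmeas (E (k i) i `&` ball point (k i)%:R).
    by apply: measurableI; [exact: mE|exact: mball_bmeas].
  rewrite setIUl (le_trans (measureU2 _ _ _))//; [exact: measurableI..|].
  rewrite [e]splitr EFinD; apply: leeD.
    by apply: (le_trans Eji); rewrite lee_fin ltW.
  apply: (@le_trans _ _ (m i (E (k i) i `&` ball point (k i)%:R))).
    by apply: le_measure; rewrite ?inE; [exact: measurableI|by []|exact: subIsetl].
  apply: (le_trans Eki); rewrite lee_fin (le_trans _ (ltW je))//.
  by rewrite lef_pV2 ?posrE// ler_nat.
Qed.

End saturation.

(** * Push-forwards under the weak approximations *)

Section push_forward.
Context {R : realType} {omega : set_system nat} (ultra : UltraFilter omega)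
  (nonprincipal : forall n, omega <> principal_filter n)
  {X : nat -> pmetricType R} {Y : pmetricType R}
  (X_polish : forall i, polish (X i)) (m : forall i, {measure set (borel (X i)) -> \bar R})
  (mY : {measure set (borel Y) -> \bar R})
  (mY_finite : boundedly_finite mY) (Y_polish : polish Y)
  (r e : nat -> R) (psi : forall i, X i -> Y) (Xt : forall i, set (X i))
  (r_oo : r i @[i --> \oo] --> +oo%R)
  (e_0 : e i @[i --> \oo] --> (0 : R))
  (psi_meas : forall i,
    measurable_fun (ball point (r i) : set (borel (X i))) (psi i : borel (X i) -> borel Y))
  (psi_point : forall i, psi i point = point)
  (Xt_meas : forall i, bmeas (Xt i))
  (Xt_ball : forall i, Xt i `<=` ball point (r i))
  (Xt_point : forall i, Xt i point)
  (Xt_dist : forall i x y, Xt i x -> Xt i y ->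
    `|mdist x y - mdist (psi i x) (psi i y)| <= e i)
  (Xt_full : forall i, (m i (ball point (r i) `\` Xt i) <= (e i)%:E)%E)
  (psi_cvg : forall f : Y -> R, Cbbs f ->
     (\int[m i]_(x in (ball point (r i) : set (borel (X i))))
        (f (psi i x))%:E)%E @[i --> \oo]
     --> (\int[mY]_(y in (setT : set (borel Y))) (f y)%:E)%E).

Notation OX := (OX ultra X).
Notation internal := (internal (ultra := ultra)).
Arguments psi : clear implicits.
Arguments Xt : clear implicits.
Arguments psi_meas : clear implicits.
Arguments psi_point : clear implicits.
Arguments Xt_meas : clear implicits.
Arguments Xt_ball : clear implicits.
Arguments Xt_point : clear implicits.
Arguments Xt_full : clear implicits.

Definition core_preimage (W : set Y) i : set (X i) := Xt i `&` psi i @^-1` W.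
Arguments core_preimage W i _ : clear implicits.

Let preimage_bmeas (W : set Y) i : bmeas W -> bmeas (ball point (r i) `&` psi i @^-1` W).
Proof. by move=> mW; exact: (psi_meas i (mball_bmeas point (r i)) W mW). Qed.

Lemma core_preimage_bmeas (W : set Y) : bmeas W -> family_bmeas (core_preimage W).
Proof.
move=> mW i; have := measurableI _ _ (Xt_meas i) (@preimage_bmeas W i mW).
by rewrite setIA (setIidl (Xt_ball i)).
Qed.

Lemma near_e (d : R) : 0 < d -> \forall i \near \oo, e i < d.
Proof. by move=> d0; apply: (cvgr_lt _ e_0). Qed.

Lemma near_r (d : R) : \forall i \near \oo, d < r i.
Proof. by have /cvgryPgt := r_oo; apply. Qed.

Let fpsi_meas (f : Y -> R) i : continuous f ->
  measurable_fun (ball point (r i) : set (borel (X i)))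
    ((fun x => f (psi i x)) : borel (X i) -> R).
Proof.
move=> cf; exact: measurableT_comp (continuous_bmeas cf) (psi_meas i).
Qed.

Lemma core_preimage_le (V : set Y) (d s c : R) : open V -> V `<=` ball point s ->
  0 < d -> (mY V < c%:E)%E -> \forall i \near \oo,
  (m i (core_preimage [set y | (d <= inradius V y)%R] i) <= c%:E)%E.
Proof.
move=> oV Vs d0 Vc; have Cf := plateau_Cbbs d0 Vs.
have cf := @plateau_continuous _ _ V d.
have f0 y : 0 <= plateau V d y by case/andP: (plateau_itv V y d0).
have intc : (\int[mY]_(y in (setT : set (borel Y))) (plateau V d y)%:E < c%:E)%E.
  apply: le_lt_trans Vc.
  have mV := open_bmeas oV.
  rewrite -[in leRHS](setIT V) -integral_indic//.
  apply: ge0_le_integral => //=.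
  - by move=> y _; rewrite lee_fin.
  - by apply/measurable_EFinP; exact: continuous_bmeas.
  - by apply/measurable_EFinP; exact: measurable_indic.
  - move=> y _; rewrite lee_fin indicE; case/andP: (plateau_itv V y d0) => _ p1.
    case: (boolP (y \in V)) => //= /negP yV; rewrite leNgt; apply/negP => p0.
    by apply: yV; rewrite inE; exact: plateau_in p0.
have mW : bmeas [set y | (d <= inradius V y)%R].
  exact: inradius_bmeas.
have intlt := cvge_lt (psi_cvg Cf) intc.
apply: filterS intlt => i /= /ltW; apply: le_trans.
pose A := core_preimage [set y | (d <= inradius V y)%R] i.
have mA : bmeas A := @core_preimage_bmeas _ mW i.
have AE : A `&` ball point (r i) = A by apply: setIidl => x [/Xt_ball].
have mball := mball_bmeas (point : X i) (r i).
rewrite -[leLHS]/(m i A) -AE -integral_indic//; apply: ge0_le_integral => //=.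
- by apply/measurable_EFinP; exact: measurable_indic.
- by apply/measurable_EFinP; exact: fpsi_meas.
- move=> x _; rewrite lee_fin indicE.
  case: (boolP (x \in _)) => [|_ /=]; last exact: f0.
  by rewrite inE => -[_ /= dx]; rewrite plateau_eq1.
Qed.

Lemma measure_bounded_fin (V : set Y) (s : R) : bmeas V -> V `<=` ball point s ->
  (mY V < +oo)%E.
Proof.
move=> mV Vs; apply: le_lt_trans (mY_finite point s).
by apply: le_measure; rewrite ?inE//; exact: mball_bmeas.
Qed.

(** The sets of depth [n.+1%:R^-1] exhaust [V], so one of them already has mass above a number [b]
    between [a] and the mass of [V]. The gap [b - a] then absorbs the mass [e i] lost outside
    [Xt i]. *)
Lemma lt_core_preimage (V : set Y) (s a : R) : open V -> V `<=` ball point s ->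
  (a%:E < mY V)%E -> \forall i \near \oo, (a%:E < m i (core_preimage V i))%E.
Proof.
move=> oV Vs aV; have mV := open_bmeas oV.
pose F n : set Y := [set y | n.+1%:R^-1 <= inradius V y].
have mF n : bmeas (F n).
  exact: inradius_bmeas.
have FV : \bigcup_n F n = V.
  apply/seteqP; split=> y.
    by move=> [n _ /= Fy]; apply: inradius_in; apply: lt_le_trans Fy; rewrite invr_gt0.
  move=> Vy; have [n] := ltr_add_invr (inradius_gt0 oV Vy).
  by rewrite add0r => /ltW Fn; exists n.
have ndF : nondecreasing_seq (F : nat -> set (borel Y)).
  move=> n k nk; apply/subsetPset => y /=; apply: le_trans.
  by rewrite lef_pV2 ?posrE// ler_nat.
have Vfin : mY V \is a fin_num by rewrite ge0_fin_numE//; exact: measure_bounded_fin Vs.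
pose b := (a + fine (mY V)) / 2.
have aV' : a < fine (mY V) by rewrite -lte_fin fineK.
have ab : a < b by rewrite /b; lra.
have bV : (b%:E < mY (\bigcup_n F n))%E by rewrite FV -[mY V]fineK// lte_fin /b; lra.
have [n bFn] := lt_measure_bigcup mF ndF bV.
pose d : R := n.+1%:R^-1.
have d0 : 0 < d by rewrite invr_gt0.
have Cf := plateau_Cbbs d0 Vs.
have cf := @plateau_continuous _ _ V d.
have f0 y : 0 <= plateau V d y by case/andP: (plateau_itv V y d0).
have intb : (b%:E < \int[mY]_(y in (setT : set (borel Y))) (plateau V d y)%:E)%E.
  apply: (lt_le_trans bFn).
  rewrite -[in leLHS](setIT (F n)) -integral_indic//.
  apply: ge0_le_integral => //=.
  - by apply/measurable_EFinP; exact: measurable_indic.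
  - by apply/measurable_EFinP; exact: continuous_bmeas.
  - move=> y _; rewrite lee_fin indicE.
    case: (boolP (y \in _)) => [|_ /=]; last exact: f0.
    by rewrite inE => /= dy; rewrite plateau_eq1.
have intlt := cvge_gt (psi_cvg Cf) intb.
have ba : 0 < b - a by rewrite subr_gt0.
apply: filterS2 intlt (near_e ba) => i /= bi ei.
have mball := mball_bmeas (point : X i) (r i).
have mA := @core_preimage_bmeas _ mV i.
have mVi := @preimage_bmeas V i mV.
have : (b%:E < m i (core_preimage V i) + (e i)%:E)%E.
  apply: (lt_le_trans bi).
  apply: (@le_trans _ _ (m i (ball point (r i) `&` psi i @^-1` V))).
    rewrite -[in leRHS](setIid (ball point (r i))) setIAC -integral_indic//.
    apply: ge0_le_integral => //=.
    - by move=> y _; rewrite lee_fin.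
    - by apply/measurable_EFinP; exact: fpsi_meas.
    - by apply/measurable_EFinP; exact: measurable_indic.
    - move=> x rx; rewrite lee_fin indicE; case/andP: (plateau_itv V (psi i x) d0) => _ p1.
      case: (boolP (x \in _)) => //= /negP xV; rewrite leNgt; apply/negP => p0.
      by apply: xV; rewrite inE; split => //; exact: plateau_in p0.
  apply: le_trans (_ : m i (core_preimage V i `|` (ball point (r i) `\` Xt i)) <= _)%E.
    apply: le_measure; rewrite ?inE//.
      by apply: measurableU => //; exact: measurableD.
    by move=> x [rx Vx]; have [?|?] := pselect (Xt i x); [left|right].
  rewrite (le_trans (measureU2 _ _ _))//; first exact: measurableD.
  by apply: leeD; [exact: lexx|exact: Xt_full].
have -> : b = a + (b - a) by lra.
move=> abi; rewrite ltNge; apply/negP => h.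
move: abi; apply/negP; rewrite -leNgt EFinD leeD// lee_fin ltW//.
Qed.

Let u := sval (cid (dense_seq Y_polish)).
Let u_dense := svalP (cid (dense_seq Y_polish)).

Lemma Xt_dist_lt i x y (d : R) : Xt i x -> Xt i y ->
  mdist (psi i x) (psi i y) < d -> mdist x y < d + e i.
Proof. by move=> Xx Xy; have := Xt_dist Xx Xy; rewrite ler_norml; lra. Qed.

Lemma Xt_dist_psi_lt i x y (d : R) : Xt i x -> Xt i y ->
  mdist x y < d -> mdist (psi i x) (psi i y) < d + e i.
Proof. by move=> Xx Xy; have := Xt_dist Xx Xy; rewrite ler_norml; lra. Qed.

Definition uncovered (M : nat) (s : R) : set Y := \bigcap_(n in `I_M) ~` ball (u n) s.

Lemma uncovered_bmeas M s : bmeas (uncovered M s).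
Proof.
apply: fin_bigcap_measurable; first exact: finite_II.
by move=> n _; apply: measurableC; exact: mball_bmeas.
Qed.

(* The finitely many balls of radius [s] exhaust a ball of finite measure in the
   limit, hence nearly all of the mass of the approximating spaces: this tightness
   replaces compactness of balls. *)
Lemma core_uncovered_le (t s c : R) : 0 < s -> 0 < c ->
  exists M, \forall i \near \oo,
  (m i (core_preimage (uncovered M s) i `&` ball point t) <= c%:E)%E.
Proof.
move=> s0 c0.
(* Closed balls are removed to make [F M] open. The point [psi i x] lies within [t + 1] of the base
   point; depth at most 1 keeps its neighbourhood within [t + 2], and depth at most [s / 2] keeps it
   off the closed balls of radius [s / 2]. *)
pose F M : set Y := ball point (t + 2) `&` \bigcap_(n in `I_M) ~` cball (u n) (s / 2).
have oF M : open (F M).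
  apply: openI; first exact: open_mball.
  rewrite bigcap_mkord; elim/big_ind: _ => //; first exact: openT.
  + exact: openI.
  + by move=> n _; exact: open_setC_cball.
have mF M : bmeas (F M) by exact: open_bmeas.
have niF : nonincreasing_seq (F : nat -> set (borel Y)).
  move=> n k nk; apply/subsetPset; apply: setIS => y Fy j /= jn.
  by apply: Fy => /=; rewrite (leq_trans jn).
have F0 : (mY (F 0%N) < +oo)%E by apply: measure_bounded_fin => //; exact: subIsetl.
have [|M FM] := @measure_bigcap_lt _ _ _ mY F c%:E mF niF F0.
  rewrite (_ : \bigcap_n F n = set0) ?measure0 ?lte_fin// -subset0 => y Fy.
  have s20 : 0 < s / 2 by rewrite divr_gt0.
  have [n /ltW ny] := u_dense y s20.
  by have [_ /(_ n (ltnSn n))] := Fy n.+1 I; apply.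
exists M; pose d := Num.min 1 (s / 2).
have d0 : 0 < d by rewrite lt_min ltr01 divr_gt0.
have Fs : F M `<=` ball point (t + 2) by exact: subIsetl.
apply: filterS2 (core_preimage_le (oF M) Fs d0 FM) (near_e ltr01) => i + ei.
apply: le_trans.
have mW : bmeas [set y | (d <= inradius (F M) y)%R].
  exact: inradius_bmeas.
apply: le_measure; rewrite ?inE.
- apply: measurableI; last exact: mball_bmeas.
  by apply: core_preimage_bmeas; exact: uncovered_bmeas.
- exact: core_preimage_bmeas.
move=> x [[Xx /= xu]]; rewrite mballE => xt; split => //=.
apply: le_inradius; first by rewrite ltW//= ge_min lexx.
have d1 : d <= 1 by rewrite ge_min lexx.
have ds : d <= s / 2 by rewrite ge_min lexx orbT.
have := Xt_dist_psi_lt (Xt_point i) Xx xt; rewrite psi_point => xt'.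
move=> y; rewrite mballE => xy; split.
  rewrite mballE; have := metric_triangle point (psi i x) y; lra.
move=> n /= nM; rewrite /cball/= => uy; apply: (xu n nM); rewrite mballE.
have := metric_triangle (u n) y (psi i x); rewrite (metric_sym y); lra.
Qed.

Lemma near_ball_r (t : R) : \forall i \near \oo,
  (ball point t : set (X i)) `<=` ball point (r i).
Proof.
apply: filterS (near_r t) => i ti x; rewrite !mballE => /lt_trans; exact.
Qed.

Lemma ball_diff_le (t c : R) : 0 < c -> \forall i \near \oo,
  (m i (ball point t `\` Xt i) <= c%:E)%E.
Proof.
move=> c0; apply: filterS2 (near_ball_r t) (near_e c0) => i tr ei.
apply: (@le_trans _ _ (e i)%:E); last by rewrite lee_fin ltW.
apply: le_trans (Xt_full i).
have ? : bmeas (ball (point : X i) t) by exact: mball_bmeas.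
have ? : bmeas (ball (point : X i) (r i)) by exact: mball_bmeas.
apply: le_measure; rewrite ?inE; [exact: measurableD..|].
by move=> x [tx Xx]; split => //; exact: tr.
Qed.

Lemma ultra_asymptotically_totally_bounded : asymptotically_totally_bounded omega m.
Proof.
split=> [t t0|t s c t0 s0 c0].
  have mV := mball_bmeas (point : Y) (t + 2).
  have Vfin : mY (ball point (t + 2)) \is a fin_num by rewrite ge0_fin_numE.
  have Vc : (mY (ball point (t + 2)) < (fine (mY (ball point (t + 2))) + 1)%:E)%E.
    by rewrite -{1}[mY _]fineK// lte_fin; lra.
  (* One unit gives a strict bound on the mass in the limit, the other bounds the mass outside
     [Xt i]. *)
  exists (fine (mY (ball point (t + 2))) + 1 + 1).
  apply: (eventually_ultra ultra nonprincipal).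
  have H := core_preimage_le (open_mball point (t + 2)) (@subset_refl _ _) ltr01 Vc.
  apply: filterS3 H (ball_diff_le t ltr01) (near_e ltr01) => i H1 H2 ei.
  have mW : bmeas [set y : Y | (1 <= inradius (ball point (t + 2)) y)%R].
    exact: inradius_bmeas.
  have mA := @core_preimage_bmeas _ mW i.
  have mB : bmeas (ball (point : X i) t) by exact: mball_bmeas.
  have mBX : bmeas ((ball point t : set (X i)) `\` Xt i) by exact: measurableD.
  rewrite EFinD; apply: le_trans (leeD H1 H2).
  apply: le_trans (measureU2 (m i) mA mBX).
  apply: le_measure; rewrite ?inE//; first exact: measurableU.
  move=> x tx; have [Xx|?] := pselect (Xt i x); last by right.
  left; split => //=; apply: le_inradius; first by rewrite lexx ler01.
  move: tx; rewrite mballE => /(Xt_dist_psi_lt (Xt_point i) Xx).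
  rewrite psi_point => xt y; rewrite !mballE => xy.
  have := metric_triangle point (psi i x) y; lra.
(* Two core points with images in the same ball of radius [s / 4] have images less than [s / 2]
   apart, so they are less than [s / 2 + e i < s] apart. *)
have s40 : 0 < s / 4 by rewrite divr_gt0.
have c20 : 0 < c / 2 by rewrite divr_gt0.
have [M HM] := core_uncovered_le (t + 1) s40 c20.
(* The centres are core points sent near [u n]; the default [point] serves the balls that no core
   point reaches. *)
exists M, (fun i n => xget point [set x | Xt i x /\ ball (u n) (s / 4) (psi i x)]).
apply: ultra_lim_le => [//|]; apply: (eventually_ultra ultra nonprincipal).
apply: filterS3 HM (ball_diff_le (t + 1) c20) (near_e s40) => i H1 H2 ei.
have mW := uncovered_bmeas M (s / 4).
have mA := @core_preimage_bmeas _ mW i.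
have mB : bmeas (ball (point : X i) (t + 1)) by exact: mball_bmeas.
have mAB : bmeas (core_preimage (uncovered M (s / 4)) i `&` ball point (t + 1)).
  exact: measurableI.
have mBX : bmeas ((ball point (t + 1) : set (X i)) `\` Xt i) by exact: measurableD.
rewrite [c]splitr EFinD; apply: le_trans (leeD H1 H2).
apply: le_trans (measureU2 (m i) mAB mBX).
apply: le_measure; rewrite ?inE.
- apply: measurableD; first exact: cball_bmeas.
  by apply: bigcup_measurable => n _; exact: mball_bmeas.
- exact: measurableU.
move=> x [/= tx nx].
have tx1 : ball point (t + 1) x by rewrite mballE (le_lt_trans tx)// ltrDl.
have [Xx|?] := pselect (Xt i x); last by right.
left; split => //; split => // n /= nM nx'; apply: nx; exists n => //.
set z := xget _ _.
have [Xz uz] : Xt i z /\ ball (u n) (s / 4) (psi i z).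
  by rewrite /z; case: xgetP => [w _ //|/(_ x)[]].
move: nx' uz; rewrite !mballE => nx' uz.
have := @Xt_dist_lt _ _ _ (s / 2) Xz Xx.
have := metric_triangle (psi i z) (u n) (psi i x).
rewrite (metric_sym _ (u n)) => h1 h2; have : mdist (psi i z) (psi i x) < s / 2 by lra.
by move=> /h2; lra.
Qed.

(** * The correspondence between the ultralimit and the limit space *)

(** A relation, since the images need not converge along [omega]. Membership in [Xt i] makes
    distances in [X i] comparable with distances between limits. *)
Definition converges_to (x : OX) (y : Y) :=
  (\forall i \near omega, Xt i (repr_family x i)) /\
  forall d : R, 0 < d -> \forall i \near omega, mdist y (psi i (repr_family x i)) < d.

Definition limit_preimage (C : set Y) : set OX :=
  [set x | exists2 y, C y & converges_to x y].

Lemma converges_to_core x y (V : set Y) : open V -> V y -> converges_to x y ->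
  internal (core_preimage V) x.
Proof.
move=> /open_mdistP oV /oV[d d0 dV] [Xx /(_ d d0) xy].
by apply: filterS2 Xx xy => i Xx xy; split => //; apply: dV; rewrite mballE.
Qed.

(** A limit in [V] has some positive depth there, so its approximants eventually have depth at least
    [n.+1%:R^-1] for some [n]. At each such depth weak convergence bounds the mass by [c], and
    saturation keeps this bound for the union over [n]. *)
Lemma small_limit_preimage (V : set Y) (s c : R) : open V -> V `<=` ball point s ->
  (mY V < c%:E)%E -> small m (limit_preimage V) c.
Proof.
move=> oV Vs Vc.
pose A n := core_preimage [set y | (n.+1%:R^-1 <= inradius V y)%R].
have mA n : family_bmeas (A n).
  by apply: core_preimage_bmeas; exact: inradius_bmeas.
apply: (@small_subset _ _ _ _ _ _ (\bigcup_n internal (A n))).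
  move=> x [y Vy [Xx xy]].
  have y0 : 0 < inradius V y / 2 by rewrite divr_gt0// inradius_gt0.
  have [n] := ltr_add_invr y0; rewrite add0r => ny; exists n => //.
  apply: filterS2 Xx (xy _ y0) => i Xx yx; split => //=.
  apply: le_trans (ltW ny) _.
  have := inradius_lipschitz V y (psi i (repr_family x i)); lra.
apply: small_nondecreasing_bigcup => //.
  move=> n k i nk x [Xx /= nx]; split => //=; apply: le_trans nx.
  by rewrite lef_pV2 ?posrE// ler_nat.
move=> n t; apply: (eventually_ultra ultra nonprincipal).
have n0 : 0 < n.+1%:R^-1 :> R by rewrite invr_gt0.
apply: filterS (core_preimage_le oV Vs n0 Vc) => i; apply: le_trans.
have ? : bmeas (ball (point : X i) t) by exact: mball_bmeas.
have ? := mA n i.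
by apply: le_measure; rewrite ?inE; [exact: measurableI|by []|exact: subIsetl].
Qed.

Lemma small_internal (A : forall i, set (X i)) (c : R) : family_bmeas A ->
  (\forall i \near \oo, (m i (A i) <= c%:E)%E) -> small m (internal A) c.
Proof.
move=> mA Ac; exists A; split => // t; apply: (eventually_ultra ultra nonprincipal).
apply: filterS Ac => i; apply: le_trans.
have ? : bmeas (ball (point : X i) t) by exact: mball_bmeas.
have ? := mA i.
by apply: le_measure; rewrite ?inE; [exact: measurableI|by []|exact: subIsetl].
Qed.

Lemma ultra_pigeonhole (P : nat -> nat -> Prop) M :
  (\forall i \near omega, exists2 k, (k < M)%N & P k i) ->
  exists k, \forall i \near omega, P k i.
Proof.
elim: M => [|M IH] PM; first by have [i []] := filter_ex PM.
have [PMi|nP] := in_ultra_setVsetC [set i | P M i] ultra; first by exists M.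
apply: IH; apply: filterS2 PM nP => i [k]; rewrite ltnS leq_eqVlt.
by case/predU1P => [-> //|kM Pk _]; exists k.
Qed.

(* Off a small internal set, [psi i (x i)] lies for each radius in one of finitely
   many balls, so by pigeonhole it is Cauchy along [omega]. *)
Lemma null_not_converging : null m (~` limit_preimage setT).
Proof.
apply: (@null_subset _ _ _ _ _ _ _
  (\bigcup_n (~` limit_preimage setT `&` internal (fun i => ball point (n%:R : R))))) => //.
  by move=> x nx; have [n xn] := OX_bounded x; exists n.
apply: null_bigcup => // t; apply/null_small => // c c0.
have c20 : 0 < c / 2 by rewrite divr_gt0.
have : forall n, exists M, \forall i \near \oo,
    (m i (core_preimage (uncovered M n.+1%:R^-1) i `&` ball point t%:R)
      <= (c / 2 / (2 ^ n.+1)%:R)%:E)%E.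
  by move=> n; apply: core_uncovered_le; rewrite ?invr_gt0// divr_gt0// ltr0n expn_gt0.
move=> /choice[M HM].
pose E n i := core_preimage (uncovered (M n) n.+1%:R^-1) i `&` ball point t%:R.
have mE n : family_bmeas (E n).
  move=> i; apply: measurableI; last exact: mball_bmeas.
  by apply: core_preimage_bmeas; exact: uncovered_bmeas.
apply: (@small_subset _ _ _ _ _ _
  (internal (fun i => ball point t%:R `\` Xt i) `|` \bigcup_n internal (E n))); last first.
  rewrite [c]splitr; apply: smallU.
    apply: small_internal; last exact: ball_diff_le.
    by move=> i; apply: measurableD; [exact: mball_bmeas|exact: Xt_meas].
  apply: small_bigcup => // [|n]; first exact: ltW.
  by apply: small_internal; [exact: mE|exact: HM].
move=> x [nx xt].
have [?|nX] := pselect (internal (fun i => ball point t%:R `\` Xt i) x); first by left.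
have [?|nE] := pselect ((\bigcup_n internal (E n)) x); first by right.
exfalso; apply: nx.
have Xx : \forall i \near omega, Xt i (repr_family x i).
  apply: filterS2 xt (internalC nX) => i xti Xi.
  by apply: contrapT => nXi; exact: Xi.
have xu n : exists k, \forall i \near omega,
    ball (u k) n.+1%:R^-1 (psi i (repr_family x i)).
  have nEn : ~ internal (E n) x by move=> ?; apply: nE; exists n.
  apply: (@ultra_pigeonhole _ (M n)).
  apply: filterS3 Xx xt (internalC nEn) => i Xi xti nEi.
  apply: contrapT => /forall2NP h; apply: nEi; split => //; split => //.
  by move=> k /= kM; case: (h k).
have FF : ProperFilter (psi i (repr_family x i) @[i --> omega]).
  exact: fmap_proper_filter.
have /Y_polish.1/cvg_ex[y xy] : cauchy (psi i (repr_family x i) @[i --> omega]).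
  apply: cauchy_exP => d d0; have [n] := ltr_add_invr d0; rewrite add0r => nd.
  have [k xk] := xu n; exists (u k); apply: filterS xk => i.
  by rewrite /= !mballE => /lt_trans; apply.
exists y => //; split => // d d0.
by move/metricType_numDomainType.cvgrPdist_lt : xy; apply.
Qed.

Lemma null_limit_preimage_setC_spt : null m (limit_preimage (~` spt mY)).
Proof.
apply: (@null_subset _ _ _ _ _ _ _
  (\bigcup_n limit_preimage (~` spt mY `&` ball point n%:R))) => //.
  move=> x [y ny xy]; exists (Num.truncn (mdist point y)).+1 => //.
  by exists y => //; split => //; rewrite mballE truncnS_gt.
apply: null_bigcup => // n; apply/null_small => // c c0.
have oV : open (~` spt mY `&` ball point (n%:R : R)).
  by apply: openI; [exact: open_setC_spt|exact: open_mball].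
apply: (@small_limit_preimage _ n%:R) => //.
apply: (@le_lt_trans _ _ (mY (~` spt mY))).
  apply: le_measure; rewrite ?inE; last exact: subIsetl.
    exact: open_bmeas.
  by apply: open_bmeas; exact: open_setC_spt.
by rewrite measure_setC_spt// lte_fin.
Qed.

(** Strictness is lost in the limit, which is why open balls of radius [t + 1] are used for limits
    of points from balls of radius [t]. *)
Lemma converges_to_ball x y (t : R) : converges_to x y ->
  internal (fun i => ball point t) x -> mdist point y <= t.
Proof.
move=> [Xx xy] xt.
suff H (d : R) : 0 < d -> mdist point y <= t + d by apply/ler_addgt0Pr.
move=> d0.
have d20 : 0 < d / 2 by rewrite divr_gt0.
have ei := eventually_ultra ultra nonprincipal (near_e d20).
have [i [[Xi yi] [xti ed]]] := filter_ex (filterI (filterI Xx (xy _ d20)) (filterI xt ei)).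
move: xti; rewrite mballE => /(Xt_dist_psi_lt (Xt_point i) Xi).
rewrite psi_point => xti.
have := metric_triangle point (psi i (repr_family x i)) y.
by move: yi ed => /=; rewrite (metric_sym y); lra.
Qed.

Lemma converges_to_core_ball x y (t : R) : converges_to x y ->
  internal (core_preimage (ball point t)) x -> mdist point y <= t.
Proof.
move=> [_ xy] xt.
suff H (d : R) : 0 < d -> mdist point y <= t + d by apply/ler_addgt0Pr.
move=> d0; have [i [yi [_ /=]]] := filter_ex (filterI (xy _ d0) xt).
rewrite mballE => xti.
have := metric_triangle point (psi i (repr_family x i)) y.
by move: yi xti => /=; rewrite (metric_sym y); lra.
Qed.

Lemma converges_to_unique x y y' : converges_to x y -> converges_to x y' -> y = y'.
Proof.
move=> [_ xy] [_ xy']; apply: mdist_positivity; apply/eqP.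
rewrite eq_le mdist_ge0 andbT.
suff H (d : R) : 0 < d -> mdist y y' <= 0 + d by apply/ler_addgt0Pr.
move=> d0; rewrite add0r.
have d20 : 0 < d / 2 by rewrite divr_gt0.
have [i [yi yi']] := filter_ex (filterI (xy _ d20) (xy' _ d20)).
have := metric_triangle y (psi i (repr_family x i)) y'.
by move: yi yi' => /=; rewrite (metric_sym (psi _ _) y'); lra.
Qed.

Lemma internal_approx_limit_preimage (C : set Y) (t : R) : bmeas C ->
  exists B, internal_algebra B /\
    null m ((limit_preimage C `&` internal (fun i => ball point t)) `+` B).
Proof.
move=> mC.
have mB0 := mball_bmeas (point : Y) (t + 1).
suff [A [mA nA]] : exists A : forall i, set (X i), family_bmeas A /\
    null m ((limit_preimage C `&` internal (fun i => ball point t)) `+` internal A).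
  by exists (internal A); split => //; exact: internal_internal_algebra.
apply: internal_saturation => // c c0.
have c20 : 0 < c / 2 by rewrite divr_gt0.
have [U [U' [oU oU' CU CU' UU']]] :=
  bmeas_regular mB0 (mY_finite point (t + 1)) mC c20.
(* [S] and [S'] are disjoint open sets containing the complements of [U'] and [U],
   that is the closed inner approximations of [C] and of its complement. *)
pose S := [set y | inradius U' y < inradius U y].
pose S' := [set y | inradius U y < inradius U' y].
have oS : open S by exact: open_lt_inradius.
have oS' : open S' by exact: open_lt_inradius.
(* The preimage of [U] would not do: a limit outside [U] may be approached from inside [U]. A limit
   in [S'] instead forces the images into [S'], away from [S]. *)
pose A i := core_preimage S i `&` ball point t.
exists A; split.
  move=> i; apply: measurableI; last exact: mball_bmeas.
  by apply: core_preimage_bmeas; exact: open_bmeas.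
pose V := U `&` U' `&` ball point (t + 1).
have oV : open V by apply: openI; [exact: openI|exact: open_mball].
apply: (@small_subset _ _ _ _ _ _ (limit_preimage V `|` ~` limit_preimage setT)); last first.
  rewrite [c]splitr; apply: smallU.
    by apply: (@small_limit_preimage _ (t + 1)) => //; exact: subIsetr.
  have /null_small := null_not_converging; exact.
move=> x xDA; have [[y _ xy]|?] := pselect (limit_preimage setT x); last by right.
left; exists y => //.
have xt : internal (fun i => ball point t) x.
  by case: xDA => -[] => [[]//|Ax _]; apply: filterS Ax => i [].
have yt : ball point (t + 1) y.
  by rewrite mballE (le_lt_trans (converges_to_ball xy xt))// ltrDl.
apply: contrapT => nVy.
have [Uy|nUy] := pselect (U y).
  have nU'y : ~ U' y by move=> ?; apply: nVy.
  have Cy : C y by apply: contrapT => /CU'.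
  have Sy : S y by rewrite /S/= inradius_eq0// inradius_gt0.
  case: xDA => -[].
    move=> _; apply.
    by apply: filterS2 (converges_to_core oS Sy xy) xt => i; split.
  by move=> Ax; apply; split => //; exists y.
have nCy : ~ C y by move=> /CU.
have S'y : S' y by rewrite /S'/= (inradius_eq0 nUy) inradius_gt0//; exact: CU'.
have xS' := converges_to_core oS' S'y xy.
case: xDA => -[].
  move=> [[y' Cy' xy'] _] _; apply: nCy.
  by rewrite (converges_to_unique xy xy').
move=> Ax _; have [i [[[_ /= h1] _] [_ /= h2]]] := filter_ex (filterI Ax xS').
by have := lt_trans h1 h2; rewrite ltxx.
Qed.

(** * Measures of limit preimages *)

Lemma bounded_fin_num (V : set Y) (s : R) : bmeas V -> V `<=` ball point s ->
  mY V \is a fin_num.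
Proof. by move=> mV Vs; rewrite ge0_fin_numE//; exact: measure_bounded_fin Vs. Qed.

(** Up to null sets, [B] consists of classes whose limit lies in an open [U] around [C], within a
    ball of radius [t + 1]. Regularity makes the excess of [U] over [C] there small. *)
Lemma internal_measure_approximant_le (C : set Y) (D B : set OX) (t : R) : bmeas C ->
  null m (D `+` limit_preimage C) -> approximant m D t B ->
  (internal_measure m B <= mY C)%E.
Proof.
move=> mC nD [iB nB].
pose W : set Y := ball point (t + 1).
have mW : bmeas W by exact: mball_bmeas.
have mCW : bmeas (C `&` W) by exact: measurableI.
have fCW : mY (C `&` W) \is a fin_num.
  by apply: bounded_fin_num mCW _; exact: subIsetr.
apply: (@le_trans _ _ (mY (C `&` W))); last first.
  by apply: le_measure; rewrite ?inE//; exact: subIsetl.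
suff H (d : R) : 0 < d -> (internal_measure m B <= mY (C `&` W) + d%:E)%E.
  exact/lee_addgt0Pr.
move=> d0; have d40 : 0 < d / 4 by rewrite divr_gt0.
have [U [U' [oU oU' CU CU' UU']]] := bmeas_regular mW (mY_finite point (t + 1)) mC d40.
have mU := open_bmeas oU; have mU' := open_bmeas oU'.
have mUUW : bmeas (U `&` U' `&` W) by apply: measurableI => //; exact: measurableI.
have UW : (mY (U `&` W) < (fine (mY (C `&` W)) + d / 2)%:E)%E.
  apply: (@le_lt_trans _ _ (mY (C `&` W) + mY (U `&` U' `&` W))%E).
    apply: le_trans (measureU2 mY mCW mUUW).
    apply: le_measure; rewrite ?inE; [exact: measurableI|exact: measurableU|].
    move=> y [Uy Wy]; have [Cy|nCy] := pselect (C y); [by left|right].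
    by split => //; split => //; exact: CU'.
  rewrite EFinD fineK//; apply: lee_ltD => //.
  by apply: (lt_le_trans UU'); rewrite lee_fin; lra.
rewrite -[mY (C `&` W)]fineK// -EFinD.
apply: internal_measure_le iB _.
rewrite (_ : _ + d = fine (mY (C `&` W)) + d / 2 + d / 2); last by lra.
apply: (@small_subset _ _ _ _ _ _ (limit_preimage (U `&` W) `|`
  ((D `+` limit_preimage C) `|`
   ((D `&` internal (fun i => ball point t)) `+` B)))); last first.
  apply: smallU.
    apply: (@small_limit_preimage _ (t + 1)) => //.
    by apply: openI => //; exact: open_mball.
  have /null_small := nullU X_polish nD nB; apply => //.
  by rewrite divr_gt0.
move=> x Bx; have [[Dx xt]|nDx] := pselect ((D `&` internal (fun i => ball point t)) x).
  have [[y Cy xy]|nCx] := pselect (limit_preimage C x); last by right; left; left.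
  left; exists y => //; split; first exact: CU.
  by rewrite /W mballE (le_lt_trans (converges_to_ball xy xt))// ltrDl.
by right; right; right.
Qed.

(** Preimages of balls slightly smaller than [W] carry mass at least that of [W] minus [d / 2]. The
    classes among them that miss [B] have, up to null sets, their limit in [U'], the open set around
    the complement of [C]; their outer content is at most the mass of [W] outside [C] plus [d / 2].
    The difference is the mass of [C] in [W] minus [d]. *)
Lemma le_internal_measure_approximant (C : set Y) (D B : set OX) (t : R) : bmeas C ->
  null m (D `+` limit_preimage C) -> approximant m D t B ->
  (mY (C `&` ball point t) <= internal_measure m B)%E.
Proof.
move=> mC nD [iB nB].
pose W : set Y := ball point t.
have mW : bmeas W by exact: mball_bmeas.
have mWC : bmeas (W `\` C) by exact: measurableD.
have fWC : mY (W `\` C) \is a fin_num.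
  by apply: bounded_fin_num mWC _; exact: subDsetl.
have fW : mY W \is a fin_num by exact: bounded_fin_num mW (@subset_refl _ _).
have fCW : mY (C `&` W) \is a fin_num.
  by apply: (@bounded_fin_num _ t); [exact: measurableI|exact: subIsetr].
have WE : fine (mY W) = fine (mY (W `\` C)) + fine (mY (C `&` W)).
  by rewrite -fineD// (measureDI mY mW mC) (setIC C).
suff H (d : R) : 0 < d -> (mY (C `&` W) <= internal_measure m B + d%:E)%E.
  exact/lee_addgt0Pr.
move=> d0; have d40 : 0 < d / 4 by rewrite divr_gt0.
have [U [U' [oU oU' CU CU' UU']]] := bmeas_regular mW (mY_finite point t) mC d40.
have mU := open_bmeas oU; have mU' := open_bmeas oU'.
have mUUW : bmeas (U `&` U' `&` W) by apply: measurableI => //; exact: measurableI.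
pose c := fine (mY (W `\` C)) + d / 4.
have UW : (mY (U' `&` W) < c%:E)%E.
  apply: (@le_lt_trans _ _ (mY (W `\` C) + mY (U `&` U' `&` W))%E).
    apply: le_trans (measureU2 mY mWC mUUW).
    apply: le_measure; rewrite ?inE; [exact: measurableI|exact: measurableU|].
    move=> y [Uy Wy]; have [Cy|nCy] := pselect (C y); [right|by left].
    by split => //; split => //; exact: CU.
  by rewrite EFinD fineK//; exact: lee_ltD.
(* Points of the smaller balls are pulled back into the ball of radius [t] in
   spite of the distortion [e i]. *)
pose F n : set Y := ball point (t - n.+1%:R^-1).
have mF n : bmeas (F n) by exact: mball_bmeas.
have FW : \bigcup_n F n = W.
  apply/seteqP; split=> y.
    move=> [n _]; rewrite /F /W !mballE => /lt_trans; apply.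
    by rewrite ltrBlDr ltrDl invr_gt0.
  rewrite /W mballE -subr_gt0 => ty; have [n] := ltr_add_invr ty; rewrite add0r => nt.
  by exists n => //; rewrite /F mballE ltrBrDl -ltrBrDr.
have ndF : nondecreasing_seq (F : nat -> set (borel Y)).
  move=> n k nk; apply/subsetPset => y; rewrite /F !mballE => /lt_le_trans; apply.
  by rewrite lerB// lef_pV2 ?posrE// ler_nat.
have : ((fine (mY W) - d / 2)%:E < mY (\bigcup_n F n))%E.
  by rewrite FW -[ltRHS]fineK// lte_fin; lra.
move=> /(lt_measure_bigcup mF ndF)[n an].
pose t' := t - n.+1%:R^-1.
have n0 : 0 < n.+1%:R^-1 :> R by rewrite invr_gt0.
pose H := core_preimage (F n).
have mH : family_bmeas H by exact: core_preimage_bmeas.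
have Ht : \forall i \near omega, H i `<=` ball point t.
  apply: filterS (eventually_ultra ultra nonprincipal (near_e n0)) => i /ltW ei x [Xx].
  rewrite /= /F !mballE -{1}(psi_point i).
  move=> /(Xt_dist_lt (Xt_point i) Xx) /lt_le_trans; apply.
  by rewrite -[leRHS](subrK n.+1%:R^-1) lerD2l; exact: ei.
have aH : \forall i \near omega, ((fine (mY W) - d / 2)%:E <= m i (H i))%E.
  have := lt_core_preimage (open_mball point t') (@subset_refl _ _) an.
  by move/(eventually_ultra ultra nonprincipal); apply: filterS => i /ltW.
have HB : small m (internal H `\` B) (c + d / 4).
  apply: (@small_subset _ _ _ _ _ _ (limit_preimage (U' `&` W) `|`
    (~` limit_preimage setT `|` ((D `+` limit_preimage C) `|`
    ((D `&` internal (fun i => ball point t)) `+` B))))); last first.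
    apply: smallU.
      apply: (@small_limit_preimage _ t) => //.
      by apply: openI => //; exact: open_mball.
    have /null_small := nullU X_polish null_not_converging (nullU X_polish nD nB); exact.
  move=> x [Hx nBx].
  have xt : internal (fun i => ball point t) x.
    by apply: filterS2 Ht Hx => i Hi; exact: Hi.
  have [[y _ xy]|?] := pselect (limit_preimage setT x); last by right; left.
  have yt' := converges_to_core_ball xy Hx.
  have Wy : W y by rewrite /W mballE (le_lt_trans yt')// ltrBlDr ltrDl.
  have [Cy|nCy] := pselect (C y); last by left; exists y => //; split => //; exact: CU'.
  right; right; have [Dx|nDx] := pselect (D x); first by right; left.
  by left; right; split => //; exists y.
have := le_internal_measure iB mH HB Ht aH.
rewrite -leeBlDr// => /(le_trans _) h.
rewrite -[leLHS]fineK// -leeBlDr//; apply: h.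
by rewrite -!EFinB lee_fin /c WE; lra.
Qed.

(** Whichever approximant is chosen at radius [t], its measure lies between the mass of [C] in the
    ball of radius [t] and the full mass of [C]; the limit in [t] is squeezed. *)
Lemma mbar_limit_preimage (C : set Y) (D : set OX) : bmeas C ->
  null m (D `+` limit_preimage C) -> mbar m D = mY C.
Proof.
move=> mC nD.
have approx (t : R) : approximant m D t (xget set0 (approximant m D t)).
  have [B [iB nB]] := internal_approx_limit_preimage t mC.
  apply: (@xgetPex _ set0 (approximant m D t)); exists B; split => //.
  apply: null_subset (nullU X_polish nD nB) => //.
  move=> x [[[Dx xt] nBx]|[Bx nDx]].
    have [Cx|nCx] := pselect (limit_preimage C x); last by left; left.
    by right; left.
  have [[Cx xt]|nCx] := pselect ((limit_preimage C `&` internal (fun i => ball point t)) x).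
    by left; right; split => // Dx; apply: nDx.
  by right; right.
have mCt (t : R) : bmeas (C `&` ball point t).
  by apply: measurableI => //; exact: mball_bmeas.
have nd : {homo (fun t : R => mY (C `&` ball point t)) : s t / s <= t >-> (s <= t)%E}.
  move=> s t st; apply: le_measure; rewrite ?inE//; apply: setIS => y.
  by rewrite !mballE => /lt_le_trans; apply.
have supE : ereal_sup (range (fun t : R => mY (C `&` ball point t))) = mY C.
  apply/eqP; rewrite eq_le; apply/andP; split.
    apply: ge_ereal_sup => _ [t _ <-].
    by apply: le_measure; rewrite ?inE//; exact: subIsetl.
  rewrite leNgt; apply/negP => supC.
  pose F n : set Y := C `&` ball point n%:R.
  have mF n : bmeas (F n) by exact: mCt.
  have ndF : nondecreasing_seq (F : nat -> set (borel Y)).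
    move=> n k nk; apply/subsetPset; apply: setIS => y.
    by rewrite !mballE => /lt_le_trans; apply; rewrite ler_nat.
  have FC : \bigcup_n F n = C.
    apply/seteqP; split=> [y [n _ []//]|y Cy].
    by exists (Num.truncn (mdist point y)).+1 => //; split => //; rewrite mballE truncnS_gt.
  move: supC; rewrite -{2}FC => /(lt_measure_bigcup mF ndF)[n].
  by apply/negP; rewrite -leNgt; apply: ereal_sup_ubound; exists n%:R.
have low := nondecreasing_cvge nd; rewrite supE in low.
apply: cvg_lim => //; apply: squeeze_cvge low (cvg_cst (mY C)).
apply: nearW => t; apply/andP; split.
  exact: le_internal_measure_approximant (approx t).
exact: internal_measure_approximant_le (approx t).
Qed.

(** Classes without a limit, or with a limit off the support, form a null set, so it suffices to
    compare [S] and [C] at limits in the support. *)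
Lemma ultrameasure_limit_preimage (C : set Y) (S : set (ultralimit ultra X)) :
  bmeas C ->
  (forall x y, spt mY y -> converges_to x y -> (S (to_ultralimit x) <-> C y)) ->
  ultrameasure m S = mY C.
Proof.
move=> mC SC; apply: mbar_limit_preimage => //.
apply: null_subset (nullU X_polish null_not_converging null_limit_preimage_setC_spt) => //.
move=> x h; have [[y _ xy]|?] := pselect (limit_preimage setT x); last by left.
right; exists y => //= sy; case: h => -[/= h1 h2]; apply: h2.
  by exists y => //; exact/(SC _ _ sy xy).
by have [z Cz xz] := h1; apply/(SC _ _ sy xy); rewrite (converges_to_unique xy xz).
Qed.

(** * Embedding of the support and isomorphism *)

Lemma dbar_converges_to x x' y y' : converges_to x y -> converges_to x' y' ->
  dbar (val x) (val x') = (mdist y y')%:E.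
Proof.
move=> [Xx xy] [Xx' xy']; apply: cvg_lim => //.
apply: cvg_EFin; first exact: nearW.
apply/cvgrPdist_lt => d d0.
suff : \forall i \near omega,
    `|mdist y y' - mdist (repr_family x i) (repr_family x' i)| < d by [].
(* One third is for the distortion and one for each of the two limits. *)
have d30 : 0 < d / 3 by rewrite divr_gt0.
have ei := eventually_ultra ultra nonprincipal (near_e d30).
have XX : \forall i \near omega, Xt i (repr_family x i) /\ Xt i (repr_family x' i).
  by apply: filterS2 Xx Xx'; split.
have yy : \forall i \near omega, mdist y (psi i (repr_family x i)) < d / 3 /\
    mdist y' (psi i (repr_family x' i)) < d / 3.
  by apply: filterS2 (xy _ d30) (xy' _ d30); split.
apply: filterS3 ei XX yy => i ei [Xi Xi'] [yi yi'].
have := Xt_dist Xi Xi'.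
set a := mdist (repr_family x i) _; set b := mdist (psi i _) _.
have h1 := metric_triangle y (psi i (repr_family x i)) y'.
have h2 := metric_triangle (psi i (repr_family x i)) (psi i (repr_family x' i)) y'.
have h3 := metric_triangle (psi i (repr_family x i)) y (psi i (repr_family x' i)).
have h4 := metric_triangle y y' (psi i (repr_family x' i)).
move: h1 h2 h3 h4; rewrite -/b.
rewrite (metric_sym (psi i (repr_family x' i)) y') (metric_sym (psi i (repr_family x i)) y).
by rewrite ler_norml ltr_norml; lra.
Qed.

Lemma mdist_to_ultralimit (x x' : OX) :
  (mdist (to_ultralimit x) (to_ultralimit x'))%:E = dbar (val x) (val x').
Proof.
have reprE (z : OX) : dbar (val (repr (to_ultralimit z))) (val z) = 0%E.
  have : (repr (to_ultralimit z) = z %[mod {eq_quot (dist0_equiv ultra X)}])%qT.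
    by rewrite reprK.
  by move/eqmodP => /eqP.
rewrite -[LHS]/((ultradist _ _)%:E) ultradistE; apply/eqP; rewrite eq_le.
apply/andP; split.
  apply: le_trans (dbar_triangle (val x) _ _) _; rewrite reprE add0e.
  apply: le_trans (dbar_triangle (val x') _ _) _.
  by rewrite (dbar_sym (val x')) reprE adde0.
apply: le_trans (dbar_triangle (val (repr (to_ultralimit x))) _ _) _.
rewrite dbar_sym reprE add0e.
apply: le_trans (dbar_triangle (val (repr (to_ultralimit x'))) _ _) _.
by rewrite reprE adde0.
Qed.

Lemma mdist_converges_to x x' y y' : converges_to x y -> converges_to x' y' ->
  mdist (to_ultralimit x) (to_ultralimit x') = mdist y y'.
Proof.
move=> xy xy'; apply/EFin_inj.
by rewrite mdist_to_ultralimit; exact: dbar_converges_to.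
Qed.

(** Every ball about a point of the support has positive mass, so its core preimages eventually have
    positive mass and are nonempty. A diagonal choice lets the radius tend to 0. *)
Lemma spt_converges_to y : spt mY y -> exists x, converges_to x y.
Proof.
move=> sy.
pose Q n i := exists x : X i, Xt i x /\ mdist y (psi i x) < n.+1%:R^-1.
have QP n : \forall i \near omega, Q n i.
  have n0 : 0 < n.+1%:R^-1 :> R by rewrite invr_gt0.
  apply: (eventually_ultra ultra nonprincipal).
  have Vs : ball y n.+1%:R^-1 `<=` ball point (mdist point y + n.+1%:R^-1).
    move=> z; rewrite !mballE => yz; apply: le_lt_trans (metric_triangle _ y _) _.
    by rewrite ltrD2l.
  have := lt_core_preimage (open_mball y _) Vs (sy _ n0); apply: filterS => i.
  move=> mi; have [[x [Xx yx]]|h] := pselect (core_preimage (ball y n.+1%:R^-1) i !=set0).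
    by exists x; split => //; move: yx; rewrite /= mballE.
  by move: mi; rewrite (_ : core_preimage _ i = set0) ?measure0 ?ltxx//;
    apply/seteqP; split => // x Ax; apply: h; exists x.
have [k [kn kQ]] := ultra_diagonal ultra nonprincipal QP.
pose x i : X i := xget point [set x | Xt i x /\ mdist y (psi i x) < (k i).+1%:R^-1].
have xP : \forall i \near omega, Xt i (x i) /\ mdist y (psi i (x i)) < (k i).+1%:R^-1.
  apply: filterS kQ => i [z zP]; rewrite /x.
  by case: xgetP => [w _ //|/(_ z)[]].
have xd (d : R) : 0 < d -> \forall i \near omega, mdist y (psi i (x i)) < d.
  move=> d0; have [n] := ltr_add_invr d0; rewrite add0r => nd.
  apply: filterS2 xP (kn n) => i [_ yx] nk; apply: lt_trans nd.
  by apply: (lt_le_trans yx); rewrite lef_pV2 ?posrE// ler_nat.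
have [z zx] : exists z : OX, \forall i \near omega, repr_family z i = x i.
  apply: (@OX_repr_family _ _ ultra X x (mdist point y + 1 + 1)).
  have ei := eventually_ultra ultra nonprincipal (near_e ltr01).
  apply: filterS3 xP (xd _ ltr01) ei => i [Xi _] yi ei.
  have := metric_triangle point y (psi i (x i)).
  have := @Xt_dist_lt _ _ _ (mdist point y + 1) (Xt_point i) Xi.
  rewrite psi_point => h1 h2; apply: ltW; apply: lt_trans (h1 _) _; first by lra.
  by rewrite ltrD2l.
exists z; split; first by apply: filterS2 zx xP => i -> [].
by move=> d /xd; apply: filterS2 zx => i ->.
Qed.

Definition embedding (y : Y) : ultralimit ultra X :=
  to_ultralimit (xget (pOX ultra X) [set x | converges_to x y]).

Lemma embeddingE x y : spt mY y -> converges_to x y -> embedding y = to_ultralimit x.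
Proof.
move=> /spt_converges_to[z zy] xy; apply: mdist_positivity.
rewrite (@mdist_converges_to _ _ y y) ?mdistxx//.
by case: xgetP => [w _ //|/(_ z)[]].
Qed.

Lemma embedding_isometry y y' : spt mY y -> spt mY y' ->
  mdist (embedding y) (embedding y') = mdist y y'.
Proof.
move=> sy sy'; have [x xy] := spt_converges_to sy; have [x' xy'] := spt_converges_to sy'.
by rewrite (embeddingE sy xy) (embeddingE sy' xy'); exact: mdist_converges_to.
Qed.

Lemma embedding_point : spt mY point -> embedding point = point.
Proof.
move=> sp; apply: embeddingE => //.
have pE : \forall i \near omega, repr_family (pOX ultra X) i = point.
  exact: repr_family_class.
split; first by apply: filterS pE => i ->.
by move=> d d0; apply: filterS pE => i ->; rewrite psi_point mdistxx.
Qed.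

Lemma closed_spt_bmeas : bmeas (spt mY).
Proof.
rewrite -[spt mY]setCK; apply: measurableC; apply: open_bmeas; exact: open_setC_spt.
Qed.

(** By the isometry, a ball about [embedding y] has the measure of the ball of the same radius about
    [y], which is positive. *)
Lemma embedding_spt y : spt mY y -> ultraspt_set (ultra := ultra) m (embedding y).
Proof.
move=> sy; left => s s0.
rewrite (@ultrameasure_limit_preimage (ball y s)); first exact: sy.
  exact: mball_bmeas.
move=> x z sz xz; rewrite !mballE -(embeddingE sz xz) embedding_isometry//.
Qed.

(** The default value sends base point to base point even when [point] lies outside the support of
    [mY]. *)
Definition support_map (y : Y) : ultraspt ultra m :=
  if pselect (spt mY y) is left sy then exist _ (embedding y) (mem_set (embedding_spt sy))
  else point.

Lemma val_support_map y : spt mY y -> set_val (support_map y) = embedding y.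
Proof. by rewrite /support_map; case: pselect. Qed.

Lemma support_map_out y : ~ spt mY y -> support_map y = point.
Proof. by rewrite /support_map; case: pselect. Qed.

Lemma support_map_isometry y y' : spt mY y -> spt mY y' ->
  mdist (support_map y) (support_map y') = mdist y y'.
Proof.
move=> sy sy'; rewrite -(embedding_isometry sy sy').
by rewrite -(val_support_map sy) -(val_support_map sy').
Qed.

Lemma support_map_point : support_map point = point.
Proof.
have [sp|/support_map_out//] := pselect (spt mY point).
by apply: val_inj; rewrite /= -[LHS]/(set_val _) val_support_map// embedding_point.
Qed.

Lemma support_map_measurable :
  measurable_fun setT (support_map : borel Y -> borel (ultraspt ultra m)).
Proof.
apply: (@measurability _ _ (borel Y) (borel (ultraspt ultra m)) setT _ (@open (ultraspt ultra m)) erefl).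
move=> _ [V oV <-]; rewrite setTI.
(* An isometry on the support is continuous there, so the preimage of [V] in the support is the
   trace of this open set. Off the support the map is constant, which contributes all or nothing of
   the complement. *)
pose W := interior (support_map @^-1` V `|` ~` spt mY).
have WE : support_map @^-1` V =
    (spt mY `&` W) `|` (if `[< V point >] then ~` spt mY else set0).
  apply/seteqP; split=> y.
    move=> Vy; have [sy|nsy] := pselect (spt mY y); last first.
      right; case: asboolP => // nVp; apply: nVp.
      by rewrite -(support_map_out nsy).
    left; split => //.
    have /open_mdistP/(_ _ Vy)[d d0 dV] := oV.
    apply/nbhs_ballP; exists d => // z; rewrite mballE => yz.
    have [sz|?] := pselect (spt mY z); last by right.
    by left; apply: dV; rewrite mballE support_map_isometry.
  move=> [[sy /interior_subset[]]|] //.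
  case: asboolP => // Vp nsy /=.
  by rewrite support_map_out.
rewrite [X in measurable X]WE; apply: measurableU.
  apply: measurableI; first exact: closed_spt_bmeas.
  by apply: open_bmeas; exact: open_interior.
case: asboolP => // _; apply: open_bmeas; exact: open_setC_spt.
Qed.

Lemma support_map_isomorphism :
  is_isomorphism mY (ultraspt_measure ultra m) support_map.
Proof.
split.
- exact: support_map_measurable.
- exact: support_map_point.
- by move=> y y' sy sy'; exact: support_map_isometry.
move=> A mA; rewrite /pushforward /ultraspt_measure.
(* The measure of [A] in the ultralimit is computed from its preimage in the limit space, which is
   Borel because [support_map] is measurable. *)
rewrite (@ultrameasure_limit_preimage (support_map @^-1` A))//.
  by have := support_map_measurable measurableT mA; rewrite setTI.
move=> x y sy xy; rewrite -(embeddingE sy xy) -(val_support_map sy).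
split=> [[a Aa /val_inj ay]|Ay]; last by exists (support_map y).
by rewrite /= -ay.
Qed.

End push_forward.


Theorem corollary11p3 (R : realType)
  (omega : set_system nat) (ultra : UltraFilter omega)
  (nonprincipal : forall n, omega <> principal_filter n)
  (X : nat -> pmetricType R)
  (m : forall i, {measure set (borel (X i)) -> \bar R})
  (X_polish : forall i, polish (X i))
  (m_finite : forall i, boundedly_finite (m i))
  (Xoo : pmetricType R)
  (moo : {measure set (borel Xoo) -> \bar R})
  (Xoo_polish : polish Xoo)
  (moo_finite : boundedly_finite moo)
  (X_cvg : wpmGH m moo) :
  asymptotically_totally_bounded omega m /\
  isomorphic moo (ultraspt_measure ultra m).
Proof.
have [r [e [psi [[_ r_oo] [_ e_0] approx psi_cvg]]]] := X_cvg.
have psi_meas i : measurable_fun (ball point (r i) : set (borel (X i)))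
    (psi i : borel (X i) -> borel Xoo) by case: (approx i).
have psi_point i : psi i point = point by case: (approx i).
have Xt_ex i : exists Xt : set (X i), [/\ bmeas Xt, Xt `<=` ball point (r i), Xt point,
    forall x y, Xt x -> Xt y -> `|mdist x y - mdist (psi i x) (psi i y)| <= e i &
    (m i (ball point (r i) `\` Xt) <= (e i)%:E)%E].
  by case: (approx i) => _ _ _ [Xt [mXt rXt pXt dXt [fXt _]]]; exists Xt.
pose Xt i := sval (cid (Xt_ex i)).
have Xt_meas i : bmeas (Xt i) by rewrite /Xt; case: cid => ? [].
have Xt_ball i : Xt i `<=` ball point (r i) by rewrite /Xt; case: cid => ? [].
have Xt_point i : Xt i point by rewrite /Xt; case: cid => ? [].
have Xt_dist i x y : Xt i x -> Xt i y ->
    `|mdist x y - mdist (psi i x) (psi i y)| <= e i.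
  by rewrite /Xt; case: cid => /= S [_ _ _ dS _]; exact: dS.
have Xt_full i : (m i (ball point (r i) `\` Xt i) <= (e i)%:E)%E.
  by rewrite /Xt; case: cid => ? [].
split.
  exact: (ultra_asymptotically_totally_bounded ultra nonprincipal moo_finite
    Xoo_polish r_oo e_0 psi_meas psi_point Xt_meas Xt_ball Xt_point Xt_dist
    Xt_full psi_cvg).
eexists; exact: (support_map_isomorphism ultra nonprincipal X_polish moo_finite
  Xoo_polish r_oo e_0 psi_meas psi_point Xt_meas Xt_ball Xt_point Xt_dist
  Xt_full psi_cvg).
Qed.
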